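(* Let $X_1,\dots,X_n$ be independent random variables, each with a probability density function $f_i\colon[-1,1]\to[0,\phi]$. Let $m\in[n]$, let $A\in\{-1,0,1\}^{m\times n}$ be a matrix of full rank, let $k\in[m-1]$ be an integer, let $(Y_1,\dots,Y_{m-k},Z_1,\dots,Z_k)^{\mathsf T}=A\cdot(X_1,\dots,X_n)^{\mathsf T}$, and let $C$ be a function mapping each tuple $(y_1,\dots,y_{m-k})\in\mathbb{R}^{m-k}$ to a hypercube $C(y_1,\dots,y_{m-k})\subseteq\mathbb{R}^k$ with side length $\varepsilon$. Then \[ \Pr\big[(Z_1,\dots,Z_k)\in C(Y_1,\dots,Y_{m-k})\big]\le(2n)^{n-k}\cdot\phi^n\cdot\varepsilon^k. \] If all densities $f_i$ are quasiconcave, then even \[ \Pr\big[(Z_1,\dots,Z_k)\in C(Y_1,\dots,Y_{m-k})\big]\le 2^k\cdot n^{n-k}\cdot\phi^k\cdot\varepsilon^k. \]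
   Context: $[n]=\{1,\dots,n\}$. A density $f\colon[-1,1]\to[0,\phi]$ is quasiconcave if there is $x_0\in[-1,1]$ such that $f$ is non-decreasing on $[-1,x_0]$ and non-increasing on $[x_0,1]$. A hypercube with side length $\varepsilon$ in $\mathbb{R}^k$ is a product of $k$ intervals of length $\varepsilon$. *)

(* Defs.v *)
From mathcomp Require Export all_boot all_order all_algebra.
From mathcomp Require Export all_classical all_reals all_analysis.

Set Implicit Arguments.
Unset Strict Implicit.
Unset Printing Implicit Defensive.

Import Order.TTheory GRing.Theory Num.Theory.
Import numFieldNormedType.Exports.

Local Open Scope classical_set_scope.
Local Open Scope ring_scope.

Definition mutually_independent (d : measure_display) (T : measurableType d)
    (R : realType) (P : probability T R) (I : finType)
    (X : I -> {RV P >-> R}) : Prop :=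
  forall (J : {set I}) (B : I -> set R),
    (forall i, measurable (B i)) ->
    P (\bigcap_(i in [set` J]) (X i @^-1` B i)) =
    (\prod_(i in J) P (X i @^-1` B i))%E.

(* A map [-1, 1] -> [0, phi] is encoded by a total function whose values
   outside [-1, 1] are never used. *)
Definition has_density (d : measure_display) (T : measurableType d)
    (R : realType) (P : probability T R) (X : {RV P >-> R})
    (phi : R) (f : R -> R) : Prop :=
  [/\ measurable_fun `[(-1 : R), 1] f,
      (forall x, x \in `[(-1 : R), 1] -> 0 <= f x <= phi) &
      forall B : set R, measurable B ->
        distribution P X B =
        (\int[lebesgue_measure]_(x in B `&` `[(-1)%R, 1%R]) (f x)%:E)%E].

Definition quasiconcave (R : realType) (f : R -> R) : Prop :=
  exists x0 : R,
    [/\ x0 \in `[-1, 1],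
        {in `[-1, x0] &, {homo f : x y / x <= y}} &
        {in `[x0, 1] &, {homo f : x y /~ x <= y}}].

(* Each of the k intervals may independently be open, closed or half-open. *)
Definition is_hypercube (R : realType) (k : nat) (eps : R)
    (H : set (k.-tuple R)) : Prop :=
  exists (a : k.-tuple R) (l r : 'I_k -> bool),
    H = [set z | forall j : 'I_k,
           tnth z j \in Interval (BSide (l j) (tnth a j))
                                 (BSide (r j) (tnth a j + eps))].

(* The first m - k, respectively the last k, coordinates of v. *)
Definition head_coords (R : realType) (m k : nat) (hkm : (k < m)%N)
    (v : 'cV[R]_m) : (m - k).-tuple R :=
  [tuple v (cast_ord (subnK (ltnW hkm)) (lshift k i)) ord0 | i < m - k].

Definition tail_coords (R : realType) (m k : nat) (hkm : (k < m)%N)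
    (v : 'cV[R]_m) : k.-tuple R :=
  [tuple v (cast_ord (subnK (ltnW hkm)) (rshift (m - k) j)) ord0 | j < k].

(* Main.v *)
(* Append unit rows to A to get an invertible n x n matrix N = (B; D) with
   entries in {-1, 0, 1}; the rows of B give Y and n - m of the X_i, the rows of
   D give Z.  As N is an integer matrix, det N is at least 1 in absolute value,
   so x |-> N x does not decrease volumes.  Hence, if B maps a set J of points x
   into W, the points of J with Dx in C(Bx) have volume at most eps^k vol(W).
   Writing the product of the densities f_i as the volume of the t with
   0 <= t_i < f_i(x_i) turns the probability into an integral over t in
   [0, phi]^n of such volumes, where J is the product of the superlevel sets
   {f_i > t_i}.  In general take W = [-n, n]^(n-k).  If the f_i are
   quasiconcave, J is a box and every point of BJ is the image of a point of J
   at most n - k of whose coordinates are not endpoints, so BJ is covered by the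
   images of (n-k)-dimensional faces; each has volume at most (n-k)! times the
   product over its free coordinates i of the length of {f_i > t_i}, and this
   length integrates to 1 over t_i. *)
From HB Require Import structures.
From mathcomp Require Import measurable_realfun ring lra zify all_fingroup.
Require Import Defs.
Set Implicit Arguments.
Unset Strict Implicit.
Unset Printing Implicit Defensive.
Import Order.TTheory GRing.Theory Num.Theory.
Import numFieldNormedType.Exports.
Local Open Scope classical_set_scope.
Local Open Scope ring_scope.

(** * Product measures and Lebesgue measure on the line *)

Section product_measure_sections.
Local Open Scope ereal_scope.
Context d1 d2 (T1 : measurableType d1) (T2 : measurableType d2) (R : realType).
Variable m1 : {sigma_finite_measure set T1 -> \bar R}.
Variable m2 : {sigma_finite_measure set T2 -> \bar R}.

Lemma product_measureE (A : set (T1 * T2)) :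
  (m1 \x m2) A = \int[m1]_x m2 [set y | A (x, y)].
Proof. by apply: eq_integral => x _ /=; rewrite xsectionE. Qed.

(** Both iterated integrals are measures with the value m1 A1 * m2 A2 on rectangles, so uniqueness
    of the product measure identifies them. *)
Lemma tonelli_sections (A : set (T1 * T2)) : measurable A ->
  \int[m1]_x m2 [set y | A (x, y)] = \int[m2]_y m1 [set x | A (x, y)].
Proof.
move=> mA; rewrite -product_measureE.
rewrite (product_measure_unique (m' := m1 \x^ m2)) //; last first.
  by move=> *; exact: product_measure2E.
by apply: eq_integral => x _ /=; rewrite ysectionE.
Qed.

Lemma measurable_section (A : set (T1 * T2)) : measurable A ->
  measurable_fun [set: T1] (fun x => m2 [set y | A (x, y)]).
Proof.
move=> mA; have := measurable_fun_xsection m2 mA.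
by congr measurable_fun; apply/funext => x /=; rewrite xsectionE.
Qed.

End product_measure_sections.

Section leb.
Context {R : realType}.

(* [lebesgue_measure] lives on [measurableTypeR R], whose display differs from
   that of the canonical sigma-algebra of [R], on which tuples are built. *)
Definition leb : set R -> \bar R := @lebesgue_measure R.

HB.instance Definition _ := isMeasure.Build _ R R leb
  (measure0 (@lebesgue_measure R)) (measure_ge0 (@lebesgue_measure R))
  (@measure_semi_sigma_additive _ _ _ (@lebesgue_measure R)).

Let leb_sigma_finite : sigma_finite setT leb.
Proof. exact: (sigma_finiteT (@lebesgue_measure R)). Qed.

HB.instance Definition _ :=
  Measure_isSigmaFinite.Build _ _ _ leb leb_sigma_finite.

Lemma leb_itv (a b : R) (l r : bool) : a <= b ->
  leb [set` Interval (BSide l a) (BSide r b)] = (b - a)%:E.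
Proof.
rewrite /leb lebesgue_measure_itv/= lte_fin le_eqVlt => /predU1P[->|->//].
by rewrite ltxx subrr.
Qed.

Lemma leb_translation (A : set R) (t : R) : measurable A ->
  leb [set x | A (x + t)] = leb A.
Proof.
move=> mA; pose f (x : measurableTypeR R) : measurableTypeR R := x + t.
have mf : measurable_fun setT f by exact: measurable_funD.
pose m := pushforward (@lebesgue_measure R) f.
rewrite [RHS](@lebesgue_measure_unique R m)// => _ [[a b]] _ <- /=.
rewrite /m /pushforward.
have -> : f @^-1` `]a, b] = `](a - t), (b - t)]%classic.
  by apply/seteqP; split => x /=; rewrite !in_itv/= /f ltrBlDr lerBrDr.
rewrite !lebesgue_measure_itv/= !lte_fin ltrD2r -!EFinB.
by congr (if _ then (_)%:E else _); ring.
Qed.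

(** A change of variables along the identity from [measurableTypeR R] to [R]; the densities are
    given in the first form. *)
Lemma integral_leb (f : R -> \bar R) : measurable_fun [set: R] f ->
  (forall x, 0 <= f x)%E ->
  (\int[lebesgue_measure]_x f x = \int[leb]_x f x)%E.
Proof.
move=> mf f0.
have mi : measurable_fun setT (idfun : measurableTypeR R -> R).
  exact: measurable_id.
exact: (esym (@ge0_integral_pushforward _ _ _ _ _ _ mi lebesgue_measure setT f measurableT mf (in1W (fun x => f0 x)))).
Qed.

End leb.

(** * Lebesgue measure on tuples *)

Section lebn_succ.
Context {R : realType} (n : nat).
Variable mu : {sigma_finite_measure set (n.-tuple R) -> \bar R}.

Definition cons_pair (p : R * n.-tuple R) : n.+1.-tuple R :=
  [tuple of p.1 :: p.2].

Lemma behead_consK (x : R) (y : n.-tuple R) :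
  [tuple of behead [tuple of x :: y]] = y.
Proof. exact/val_inj. Qed.

Lemma measurable_cons_pair : measurable_fun setT cons_pair.
Proof. exact: measurable_cons. Qed.

Definition lebn_succ (A : set (n.+1.-tuple R)) : \bar R :=
  pushforward (leb \x mu)%E cons_pair A.

Let lebn_succ0 : lebn_succ set0 = 0%E.
Proof. by rewrite /lebn_succ /pushforward preimage_set0 measure0. Qed.

Let lebn_succ_ge0 A : (0 <= lebn_succ A)%E.
Proof. exact: (measure_ge0 (leb \x mu)%E). Qed.

Let lebn_succ_sigma_additive : semi_sigma_additive lebn_succ.
Proof.
move=> F mF tF mUF.
rewrite /lebn_succ /pushforward preimage_bigcup.
apply: (@measure_semi_sigma_additive _ _ _ (leb \x mu)%E (fun i => cons_pair @^-1` F i)).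
- by move=> i; rewrite -[X in measurable X]setTI; exact: measurable_cons_pair.
- apply/trivIsetP => /= i j _ _ ij; rewrite -preimage_setI.
  by move/trivIsetP : tF => /(_ _ _ _ _ ij) ->//; rewrite preimage_set0.
- rewrite -preimage_bigcup -[X in measurable X]setTI.
  exact: measurable_cons_pair.
Qed.

HB.instance Definition _ := isMeasure.Build _ _ _ lebn_succ
  lebn_succ0 lebn_succ_ge0 lebn_succ_sigma_additive.

Let lebn_succ_sigma_finite : sigma_finite setT lebn_succ.
Proof.
have /sigma_finiteP[F [TF ndF Foo]] := sigma_finiteT (@leb R).
have /sigma_finiteP[G [TG ndG Goo]] := sigma_finiteT mu.
(* Products of the two exhausting sequences. Both are nondecreasing, so a point entering them at
   stages i and j lies in the product at stage [maxn i j]. *)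
exists (fun k => [set x | F k (thead x) /\ G k [tuple of behead x]]).
  apply/seteqP; split => // x _.
  have [i _ Fi] : (\bigcup_i F i) (thead x) by rewrite -TF.
  have [j _ Gj] : (\bigcup_i G i) [tuple of behead x] by rewrite -TG.
  exists (maxn i j) => //; split.
    by move: (thead x) Fi; exact/subsetPset/ndF/leq_maxl.
  by move: Gj; move: [tuple of _]; exact/subsetPset/ndG/leq_maxr.
move=> k; have [mF Fk] := Foo k; have [mG Gk] := Goo k; split.
  apply: measurableI.
    by rewrite -[X in measurable X]setTI; exact: measurable_tnth.
  by rewrite -[X in measurable X]setTI; exact: measurable_behead.
rewrite /lebn_succ /pushforward.
rewrite (_ : _ @^-1` _ = F k `*` G k).
  by rewrite product_measure1E// lte_mul_pinfty// ge0_fin_numE.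
by apply/seteqP; split => -[x y] /=; rewrite theadE behead_consK.
Qed.

HB.instance Definition _ := Measure_isSigmaFinite.Build _ _ _ lebn_succ
  lebn_succ_sigma_finite.

End lebn_succ.

(** Lebesgue measure on R^n by recursion on the coordinates. In dimension 0 it is the Dirac mass at
    the empty tuple, so that the empty product of lengths is 1. *)
Fixpoint lebn {R : realType} (n : nat) :
    {sigma_finite_measure set (n.-tuple R) -> \bar R} :=
  if n is n'.+1 then lebn_succ (lebn n') else \d_[tuple].

Section lebn_theory.
Context {R : realType}.
Implicit Types n : nat.

Lemma measurable_box n (B : 'I_n -> set R) : (forall i, measurable (B i)) ->
  measurable [set x : n.-tuple R | forall i, B i (tnth x i)].
Proof.
move=> mB; rewrite (_ : [set _ | _] =
    \bigcap_(i in [set: 'I_n]) ((@tnth n R)^~ i @^-1` B i)); last first.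
  by apply/seteqP; split => x /= h i; [move=> _|]; exact: h.
apply: fin_bigcap_measurable => // i _.
by rewrite -[X in measurable X]setTI; exact: measurable_tnth.
Qed.

Lemma emeasurable_prod d (T : measurableType d) (I : Type) (s : seq I)
    (h : I -> T -> \bar R) : (forall i, measurable_fun setT (h i)) ->
  measurable_fun setT (fun x => \prod_(i <- s) h i x)%E.
Proof.
move=> mh; elim: s => [|i s IH].
  by under eq_fun do rewrite big_nil; exact: measurable_cst.
by under eq_fun do rewrite big_cons; exact: emeasurable_funM.
Qed.

(** Tonelli separates the first coordinate from the rest; its factor leaves the inner integral and
    induction evaluates what remains. *)
Lemma integral_lebn_prod n (g : 'I_n -> R -> \bar R) :
  (forall i, measurable_fun setT (g i)) -> (forall i x, 0 <= g i x)%E ->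
  (\int[lebn n]_x \prod_(i < n) g i (tnth x i) = \prod_(i < n) \int[leb]_x g i x)%E.
Proof.
elim: n g => [|n IH] g mg g0.
  rewrite big_ord0 /=; under eq_integral do rewrite big_ord0.
  by rewrite integral_cst//= diracT mule1.
rewrite [LHS](@ge0_integral_pushforward _ _ _ _ _ _ (@measurable_cons_pair R n)
  (leb \x lebn n)%E) //=; last 2 first.
- apply: emeasurable_prod => i.
  by apply: measurableT_comp => //; exact: measurable_tnth.
- by move=> x _; exact: prode_ge0.
rewrite preimage_setT /comp /=.
under eq_integral => x _.
  rewrite big_ord_recl tnth0.
  under eq_bigr do rewrite tnthS.
  over.
pose h (p : R * n.-tuple R) : \bar R :=
  (\prod_(i < n) g (lift ord0 i) (tnth p.2 i))%E.
have mh : measurable_fun setT h.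
  apply: emeasurable_prod => i; apply: measurableT_comp => //.
  by apply: (measurableT_comp (measurable_tnth _)).
rewrite (fubini_tonelli1 (fun p => g ord0 p.1 * h p)%E)/=; last 2 first.
- apply: emeasurable_funM => //.
  exact: measurableT_comp.
- by move=> x; rewrite mule_ge0// prode_ge0.
rewrite big_ord_recl /fubini_F /=.
transitivity (\int[leb]_x (g ord0 x * \prod_(i < n) \int[leb]_x g (lift ord0 i) x))%E.
  apply: eq_integral => x _.
  rewrite ge0_integralZl//; [|exact: measurableT_comp|by move=> *; exact: prode_ge0].
  by congr (_ * _)%E; exact: IH.
rewrite ge0_integralZr//.
by apply: prode_ge0 => i _; exact: integral_ge0.
Qed.

Lemma lebn_box n (B : 'I_n -> set R) : (forall i, measurable (B i)) ->
  lebn n [set x | forall i, B i (tnth x i)] = (\prod_(i < n) leb (B i))%E.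
Proof.
move=> mB.
rewrite -[X in lebn n X]setIT -integral_indic//; last exact: measurable_box.
transitivity (\int[lebn n]_x \prod_(i < n) (\1_(B i) (tnth x i))%:E)%E.
  apply: eq_integral => x _; rewrite prodEFin; congr EFin.
  rewrite indicE; have [|xB] := boolP (x \in _).
    rewrite inE/= => xB.
    by rewrite big1// => i _; rewrite indicE mem_set.
  have [i xBi] : exists i, ~ B i (tnth x i).
    by apply/existsNP => xB'; move/negP : xB; apply; rewrite inE.
  by rewrite (bigD1 i)//= indicE memNset// mul0r.
rewrite (integral_lebn_prod (g := fun i x => (\1_(B i) x)%:E)) => [|i|i x].
- by apply: eq_bigr => i _; rewrite integral_indic// setIT.
- by apply/measurable_EFinP; exact: measurable_indic.
- by rewrite lee_fin.
Qed.

(** Boxes with measurable sides form a pi-system generating the sigma-algebra on tuples, and the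
    cubes [-N, N]^n, of finite measure, exhaust the space. *)
Lemma measure_box_unique n (m1 m2 : {measure set (n.-tuple R) -> \bar R}) :
  (forall B : 'I_n -> set R, (forall i, measurable (B i)) ->
    m1 [set x | forall i, B i (tnth x i)] =
    m2 [set x | forall i, B i (tnth x i)]) ->
  (forall N : nat,
    (m1 [set x | forall i, tnth x i \in `[(- N%:R)%R, N%:R] ] < +oo)%E) ->
  forall A, measurable A -> m1 A = m2 A.
Proof.
move=> m12 m1oo.
pose G := [set A | exists2 B : 'I_n -> set R, (forall i, measurable (B i)) &
   A = [set x | forall i, B i (tnth x i)]].
apply: (measure_unique G
  (fun N : nat => [set x | forall i, tnth x i \in `[(- N%:R), N%:R] ])) => //.
- apply/seteqP; split.
    apply: smallest_sub; first exact: smallest_sigma_algebra.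
    rewrite -bigcup_seq => A [i _] [B mB <-].
    apply: sub_sigma_algebra; exists (fun j => if j == i then B else setT).
      by move=> j; case: ifP.
    apply/seteqP; split => x /=.
      by move=> [_ xB] j; case: eqP => // ->.
    by move=> /(_ i); rewrite eqxx.
  apply: smallest_sub; first exact: sigma_algebra_measurable.
  by move=> _ [B mB ->]; exact: measurable_box.
- move=> _ _ [B mB ->] [B' mB' ->]; exists (fun i => B i `&` B' i).
    by move=> i; exact: measurableI.
  apply/seteqP; split => x /=; first by move=> [h h'] i.
  by move=> h; split => i; have [] := h i.
- by move=> N; exists (fun=> `[(- N%:R), N%:R]%classic).
- apply/seteqP; split => // x _.
  have : exists N : nat, forall i, `|tnth x i| <= N%:R.
    exists (Num.bound (\sum_i `|tnth x i|)) => i.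
    apply/ltW/(le_lt_trans _ (archi_boundP _)); last exact: sumr_ge0.
    by rewrite (bigD1 i)//= lerDl sumr_ge0.
  by move=> [N xN]; exists N => // i /=; rewrite in_itv/= -ler_norml.
- by move=> _ [B mB ->]; exact: m12.
Qed.

End lebn_theory.

(** * Tuples as column vectors *)

Section tuple_col.
Context {R : realType}.

(** Tuples carry the sigma-algebra and column vectors the linear algebra; [colt] and [tcol] pass
    between the two. *)
Definition colt n (x : n.-tuple R) : 'cV[R]_n := \col_i tnth x i.
Definition tcol n (v : 'cV[R]_n) : n.-tuple R := [tuple v i ord0 | i < n].

Lemma coltK n : cancel (@colt n) (@tcol n).
Proof. by move=> x; apply/eq_from_tnth => i; rewrite tnth_mktuple mxE. Qed.

Lemma tcolK n : cancel (@tcol n) (@colt n).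
Proof. by move=> v; apply/colP => i; rewrite mxE tnth_mktuple. Qed.

Lemma tnth_tcol n (v : 'cV[R]_n) i : tnth (tcol v) i = v i ord0.
Proof. by rewrite tnth_mktuple. Qed.

Lemma measurable_affine m n (M : 'M[R]_(m, n)) (v : 'cV[R]_m) :
  measurable_fun setT (fun x : n.-tuple R => tcol (M *m colt x + v)).
Proof.
apply/measurable_fun_tnthP => i /=.
rewrite (_ : _ \o _ = fun x => (\sum_j M i j * tnth x j) + v i ord0); last first.
  apply/funext => x /=; rewrite tnth_tcol !mxE; congr (_ + _).
  by apply: eq_bigr => j _; rewrite mxE.
apply: measurable_funD => //; apply: measurable_sum => j.
by apply: measurable_funM => //; exact: measurable_tnth.
Qed.

Lemma measurable_translation n (v : 'cV[R]_n) :
  measurable_fun setT (fun x : n.-tuple R => tcol (colt x + v)).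
Proof.
have := measurable_affine 1%:M v.
by congr measurable_fun; apply/funext => x; rewrite mul1mx.
Qed.

Lemma measurable_mulmx m n (M : 'M[R]_(m, n)) :
  measurable_fun setT (fun x : n.-tuple R => tcol (M *m colt x)).
Proof.
have := measurable_affine M 0.
by congr measurable_fun; apply/funext => x; rewrite addr0.
Qed.

Lemma measurable_cat r k :
  measurable_fun setT
    (fun p : r.-tuple R * k.-tuple R => [tuple of p.1 ++ p.2]).
Proof.
apply/measurable_fun_tnthP => i /=; rewrite -(splitK i).
case: (fintype.split i) => j /=.
  rewrite (_ : _ \o _ = (fun y => tnth y j) \o fst).
    by apply: measurableT_comp => //; exact: measurable_tnth.
  by apply/funext => x /=; rewrite tnth_lshift.
rewrite (_ : _ \o _ = (fun y => tnth y j) \o snd).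
  by apply: measurableT_comp => //; exact: measurable_tnth.
by apply/funext => x /=; rewrite tnth_rshift.
Qed.

Lemma lebn_cube_lty n (N : nat) :
  (lebn n [set x : n.-tuple R | forall i, tnth x i \in `[(- N%:R)%R, N%:R] ] <
   +oo)%E.
Proof.
have NN : - N%:R <= N%:R :> R by rewrite (le_trans _ (ler0n R N))// oppr_le0.
rewrite (@lebn_box _ n (fun=> `[(- N%:R), N%:R]%classic))//.
under eq_bigr do rewrite leb_itv//.
by rewrite prodEFin ltry.
Qed.

(** Both sides are measures in A, and on boxes the claim reduces to translation invariance on the
    line, one coordinate at a time. *)
Lemma lebn_translation n (v : 'cV[R]_n) (A : set (n.-tuple R)) : measurable A ->
  lebn n [set x | A (tcol (colt x + v))] = lebn n A.
Proof.
have mv := measurable_translation v.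
move=> mA; apply/esym; move: A mA.
apply: (@measure_box_unique _ n (lebn n) (pushforward (lebn n) _)) => //.
  move=> B mB; rewrite /pushforward/=.
  rewrite [X in _ = lebn n X](_ : _ =
      [set x | forall i, [set y | B i (y + v i ord0)] (tnth x i)]).
    rewrite lebn_box// (lebn_box (B := fun i => [set y | B i (y + v i ord0)])).
      by apply: eq_bigr => i _; rewrite leb_translation.
    move=> i; rewrite -[X in measurable X]setTI.
    suff : measurable_fun [set: R] (fun y => y + v i ord0) by apply.
    exact: measurable_funD.
  by apply/seteqP; split => x /= h i; have := h i; rewrite tnth_tcol !mxE.
exact: lebn_cube_lty.
Qed.

(** Lets the volume of a set of pairs (y, z) be computed by slicing at fixed y. Both measures give a
    box the product of the measures of its sides. *)
Lemma lebn_cat r k (A : set ((r + k).-tuple R)) : measurable A ->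
  lebn (r + k) A = (lebn r \x lebn k)%E 
    [set p : r.-tuple R * k.-tuple R | A [tuple of p.1 ++ p.2]].
Proof.
have mc := @measurable_cat r k.
move: A; apply: (@measure_box_unique _ (r + k) (lebn (r + k))
   (pushforward (lebn r \x lebn k)%E _)) => //; last exact: lebn_cube_lty.
move=> B mB.
transitivity ((lebn r \x lebn k)%E
  ([set y | forall i, B (lshift k i) (tnth y i)] `*`
   [set z | forall j, B (rshift r j) (tnth z j)])).
  have mBl : measurable [set y : r.-tuple R | forall i, B (lshift k i) (tnth y i)].
    exact: (measurable_box (B := fun i => B (lshift k i))).
  have mBr : measurable [set z : k.-tuple R | forall j, B (rshift r j) (tnth z j)].
    exact: (measurable_box (B := fun j => B (rshift r j))).
  rewrite product_measure1E//.
  transitivity (\prod_(i < r + k) leb (B i))%E; first exact: lebn_box.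
  rewrite big_split_ord; congr (_ * _)%E; apply/esym.
    exact: (lebn_box (B := fun i => B (lshift k i))).
  exact: (lebn_box (B := fun j => B (rshift r j))).
congr ((lebn r \x lebn k)%E _); apply/seteqP; split => -[y z] /=.
  move=> [hy hz] i; rewrite -(splitK i); case: (fintype.split i) => j /=.
    by rewrite tnth_lshift.
  by rewrite tnth_rshift.
by move=> h; split => i; [have := h (lshift k i)|have := h (rshift r i)];
  rewrite (tnth_lshift, tnth_rshift).
Qed.

End tuple_col.

(** * Linear changes of variables *)

Section scale.
Context {R : realType}.

(** Half-open, so that its integer translates tile the space without overlap. *)
Definition cube n : set (n.-tuple R) := [set x | forall i, tnth x i \in `[0, 1[ ].

(** For invertible M, the factor by which taking preimages under M multiplies volumes
    ([lebn_mulmx]); for integer matrices it is 1 / |det M| ([scale_int]). *)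
Definition scale n (M : 'M[R]_n) : \bar R :=
  lebn n [set x | cube (tcol (M *m colt x))].

Lemma measurable_cube n : measurable (@cube n).
Proof. exact: (@measurable_box _ _ (fun=> `[0, 1[%classic)). Qed.

Lemma lebn_cube n : lebn n (@cube n) = 1%E.
Proof.
rewrite (@lebn_box _ _ (fun=> `[0, 1[%classic))// big1// => i _.
by rewrite leb_itv// subr0.
Qed.

Lemma measurable_preimage_mulmx m n (M : 'M[R]_(m, n)) A : measurable A ->
  measurable [set x | A (tcol (M *m colt x))].
Proof.
by move=> mA; rewrite -[X in measurable X]setTI; exact: measurable_mulmx.
Qed.

(** The map is the block row (M N) applied to the concatenated tuple. *)
Lemma measurable_affine2 m n p (M : 'M[R]_(p, m)) (N : 'M[R]_(p, n))  A :
  measurable A ->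
  measurable [set q : m.-tuple R * n.-tuple R |
    A (tcol (M *m colt q.1 + N *m colt q.2))].
Proof.
move=> mA; rewrite (_ : [set _ | _] =
    (fun q : m.-tuple R * n.-tuple R => [tuple of q.1 ++ q.2]) @^-1`
    [set x | A (tcol (row_mx M N *m colt x))]).
  rewrite -[X in measurable X]setTI; apply: measurable_cat => //.
  exact: measurable_preimage_mulmx.
apply/seteqP; split => -[x y] /=;
 rewrite (_ : colt [tuple of _ ++ _] = col_mx (colt x) (colt y)) ?mul_row_col//;
 apply/colP => i; rewrite !mxE; case: split_ordP => j ->;
 by rewrite mxE ?tnth_lshift ?tnth_rshift.
Qed.

Lemma integral_indicZ d (T : measurableType d) (mu : {measure set T -> \bar R})
    (A : set T) (c : \bar R) : measurable A -> (0 <= c)%E ->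
  (\int[mu]_x ((\1_A x)%:E * c) = mu A * c)%E.
Proof.
move=> mA c0; rewrite ge0_integralZr//; first by rewrite integral_indic// setIT.
by apply/measurable_EFinP; exact: measurable_indic.
Qed.

Lemma measure_guard d (T : measurableType d) (mu : {measure set T -> \bar R})
    (U : Type) (H : set U) (t : U) (B : set T) :
  mu [set x | H t /\ B x] = ((\1_H t)%:E * mu B)%E.
Proof.
rewrite indicE; have [Ht|nHt] := pselect (H t).
  rewrite mem_set// mul1e; congr (mu _).
  by apply/seteqP; split => x // [].
rewrite memNset// mul0e -(measure0 mu); congr (mu _).
by apply/seteqP; split => x // [].
Qed.

(* Integrate 1_H(t) 1_A(M x + t) in both orders, for H the opposite of the unit
   cube: translation invariance evaluates one as vol(M^-1 A) vol(H) and the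
   other as vol(A) times the volume of the preimage of the cube. *)
Lemma lebn_mulmx n (M : 'M[R]_n) A : M \in unitmx -> measurable A ->
  lebn n [set x | A (tcol (M *m colt x))] = (lebn n A * scale M)%E.
Proof.
move=> uM mA; set mu := lebn n.
pose H : set (n.-tuple R) := [set t | cube (tcol (- colt t))].
have mH : measurable H.
  have := measurable_preimage_mulmx (- 1%:M) (@measurable_cube n).
  by under eq_set do rewrite mulNmx mul1mx.
have muH : mu H = 1%E.
  rewrite /mu (_ : H = [set x | forall i, tnth x i \in `]-1, 0] ]).
    rewrite (@lebn_box _ _ (fun=> `]-1, 0]%classic))// big1// => i _.
    by rewrite leb_itv ?lerN10// sub0r opprK.
  have HE (x : n.-tuple R) i :
      (tnth (tcol (- colt x)) i \in `[0, 1[) = (tnth x i \in `]-1, 0]).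
    by rewrite tnth_tcol mxE mxE !in_itv/= oppr_ge0 ltrNl andbC.
  by apply/seteqP; split => x /= h i; [rewrite -HE|rewrite HE]; exact: h.
have step1 : (\int[mu]_t mu [set x | H t /\ A (tcol (M *m colt x + colt t))] =
    mu [set x | A (tcol (M *m colt x))])%E.
  rewrite -[RHS]mul1e -muH -integral_indicZ//; apply: eq_integral => t _.
  rewrite measure_guard; congr (_ * _)%E.
  rewrite -(lebn_translation (invmx M *m colt t)
    (measurable_preimage_mulmx M mA)).
  congr (mu _); apply/seteqP; split => x /=;
  by rewrite tcolK mulmxDr mulKVmx.
have mHA : measurable [set p : n.-tuple R * n.-tuple R |
    H p.1 /\ A (tcol (M *m colt p.2 + colt p.1))].
  apply: measurableI.
    by rewrite -[X in measurable X]setTI; exact: measurable_fst.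
  have := measurable_affine2 1%:M M mA.
  by under eq_set do rewrite mul1mx addrC.
have mHA' : measurable [set p : n.-tuple R * n.-tuple R |
    A p.1 /\ H (tcol (colt p.1 - M *m colt p.2))].
  apply: measurableI.
    by rewrite -[X in measurable X]setTI; exact: measurable_fst.
  have := measurable_affine2 1%:M (- M) mH.
  by under eq_set do rewrite mul1mx mulNmx.
rewrite -step1 (tonelli_sections mu mu mHA)/=.
(* For fixed x, translating t by M x moves the dependence on x from A to H. *)
transitivity (\int[mu]_x mu [set t | A t /\ H (tcol (colt t - M *m colt x))])%E.
  apply: eq_integral => x _.
  rewrite -[RHS](@lebn_translation _ _ (M *m colt x)); last first.
    apply: measurableI => //.
    have := measurable_translation (- (M *m colt x)).
    by move=> /(_ measurableT _ mH); rewrite setTI.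
  congr (mu _); apply/seteqP; split => t /= []; rewrite tcolK addrK coltK addrC//.
rewrite -(tonelli_sections mu mu mHA')/= -integral_indicZ//.
apply: eq_integral => t _; rewrite measure_guard; congr (_ * _)%E.
rewrite /scale -[RHS](@lebn_translation _ _ (- (invmx M *m colt t))); last first.
  by apply: measurable_preimage_mulmx; exact: measurable_cube.
congr (mu _); apply/seteqP; split => x /=;
by rewrite /H/= !tcolK mulmxBr mulKVmx// opprB.
Qed.

Lemma scale_ge0 n (M : 'M[R]_n) : (0 <= scale M)%E.
Proof. exact: measure_ge0. Qed.

Lemma scaleM n (M N : 'M[R]_n) : M \in unitmx -> N \in unitmx ->
  scale (M *m N) = (scale M * scale N)%E.
Proof.
move=> uM uN; rewrite {1}/scale.
under eq_set do rewrite -mulmxA -[N *m _]tcolK.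
rewrite (lebn_mulmx uN (measurable_preimage_mulmx M (@measurable_cube n))).
by [].
Qed.

Lemma scale1 n : scale (1%:M : 'M[R]_n) = 1%E.
Proof.
by rewrite /scale; under eq_set do rewrite mul1mx coltK; rewrite lebn_cube.
Qed.

End scale.

(** * Integer matrices and their determinants *)

Section integer_matrices.
Context {R : realType}.

Local Notation intmx M := (map_mx (intr : int -> R) M).

(** Two integers that shift the same real into [0, 1[ differ by less than 1, hence agree. With
    [cube_int_ex], the integer translates of the cube partition the space. *)
Lemma cube_int_inj n (u : 'cV[R]_n) (v w : 'cV[int]_n) :
  cube (tcol (u + intmx v)) -> cube (tcol (u + intmx w)) -> v = w.
Proof.
move=> hv hw; apply/colP => i; have := hv i; have := hw i.
rewrite !tnth_tcol !mxE !in_itv/= => /andP[w0 w1] /andP[v0 v1].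
apply/eqP; rewrite eq_le -!ltzD1 -!(ltr_int R) !intrD; apply/andP; split; lra.
Qed.

Lemma cube_int_ex n (u : 'cV[R]_n) : exists v : 'cV[int]_n,
  cube (tcol (u + intmx v)).
Proof.
exists (\col_i - Num.floor (u i ord0)) => i.
rewrite tnth_tcol !mxE in_itv/= rmorphN/=.
have := floorD1_gt (u i ord0); have := floor_le (u i ord0); rewrite intrD.
by move=> ? ?; apply/andP; split; lra.
Qed.

Lemma unitmx_int n (M : 'M[int]_n) : \det M != 0 -> intmx M \in unitmx.
Proof. by move=> M0; rewrite unitmxE det_map_mx unitfE intr_eq0. Qed.

(* The integer translates of the preimage Q of the unit cube under M are
   disjoint; cutting Q along the integer grid and translating the pieces back
   packs it into the unit cube. *)
Lemma scale_int_le1 n (M : 'M[int]_n) : \det M != 0 ->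
  (scale (intmx M) <= 1)%E.
Proof.
move=> M0; rewrite /scale; set Q := [set x | _].
have mQ : measurable Q.
  by apply: measurable_preimage_mulmx; exact: measurable_cube.
pose F (v : 'cV[int]_n) : set (n.-tuple R) :=
  [set x | Q x /\ cube (tcol (colt x + intmx v))].
pose G (v : 'cV[int]_n) : set (n.-tuple R) :=
  [set x | Q (tcol (colt x - intmx v)) /\ cube x].
have mshift (v : 'cV[R]_n) A : measurable A ->
    measurable [set x | A (tcol (colt x + v))].
  by move=> mA; rewrite -[X in measurable X]setTI; exact: measurable_translation.
have mF v : measurable (F v).
  by apply: measurableI => //; apply: mshift; exact: measurable_cube.
have mG v : measurable (G v).
  by apply: measurableI; [exact: mshift|exact: measurable_cube].
have FG v : lebn n (F v) = lebn n (G v).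
  rewrite -[LHS](@lebn_translation _ _ (- intmx v))//; congr (lebn n _).
  by apply/seteqP; split => x; rewrite /F/G/= tcolK subrK coltK.
(* Integer vectors are countable: [pickle_inv] decodes k to a vector, and a k that decodes to none
   contributes the empty set. *)
pose seqof (H : 'cV[int]_n -> set (n.-tuple R)) (k : nat) :=
  if pickle_inv k is Some v then H v else set0.
have mseq H : (forall v, measurable (H v)) -> forall k, measurable (seqof H k).
  by move=> mH k; rewrite /seqof; case: pickle_inv.
have tseq (H : 'cV[int]_n -> set (n.-tuple R)) :
    (forall v w x, H v x -> H w x -> v = w) -> trivIset setT (seqof H).
  move=> Hinj; apply/trivIsetP => i j _ _ ij; apply/seteqP; split => // x [].
  rewrite /seqof; have := @pickle_invK 'cV[int]_n i; have := @pickle_invK 'cV[int]_n j.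
  case: pickle_inv => //= v vj; case: pickle_inv => //= w wi Hw Hv.
  by move: ij; rewrite -wi -vj (Hinj _ _ _ Hv Hw) eqxx.
have -> : Q = \bigcup_k seqof F k.
  apply/seteqP; split => x.
    move=> Qx; have [v xv] := cube_int_ex (colt x).
    by exists (pickle v) => //; rewrite /seqof pickleK_inv.
  by move=> [k _]; rewrite /seqof; case: pickle_inv => // v [].
rewrite measure_bigcup//; last 2 first.
- by move=> k _; exact: mseq.
- by apply: tseq => v w x [_ +] [_]; exact: cube_int_inj.
rewrite (eq_eseriesr (g := fun k => lebn n (seqof G k))); last first.
  by move=> k _; rewrite /seqof; case: pickle_inv.
rewrite -measure_bigcup; last 2 first.
- by move=> k _; exact: mseq.
(* If M (x - v) and M (x - w) both lie in the unit cube, then M v = M w by [cube_int_inj], and v = w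
   as M is invertible over the reals. *)
- apply: tseq => v w x [+ _] [+ _]; rewrite /Q/= !tcolK !mulmxBr.
  rewrite -!map_mxM -!map_mxN => /cube_int_inj/[apply] /oppr_inj vw.
  have : intmx M *m intmx v = intmx M *m intmx w by rewrite -!map_mxM vw.
  move/(congr1 (mulmx (invmx (intmx M)))); rewrite !mulKmx ?unitmx_int//.
  by move/matrixP => vw'; apply/matrixP => i j;
    have := vw' i j; rewrite !mxE => /intr_inj.
rewrite -(@lebn_cube R n); apply: le_measure; rewrite ?inE.
- by apply: bigcup_measurable => k _; exact: mseq.
- exact: measurable_cube.
- by move=> x [k _]; rewrite /seqof; case: pickle_inv => // v [].
Qed.

(** L and its inverse are both integer matrices, so both scales are at most 1, while their product
    is the scale of the identity, which is 1. *)
Lemma scale_unimodular n (L : 'M[int]_n) : L \in unitmx ->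
  scale (intmx L) = 1%E.
Proof.
move=> uL; have L0 : \det L != 0 by apply/eqP => L0; move: uL; rewrite unitmxE L0 unitr0.
have L'0 : \det (invmx L) != 0.
  by apply/eqP => L'0; move: uL; rewrite -unitmx_inv unitmxE L'0 unitr0.
have : scale (intmx L *m intmx (invmx L)) = 1%E.
  by rewrite -map_mxM mulmxV// map_mx1 scale1.
rewrite scaleM ?unitmx_int// => LL'; apply/eqP.
rewrite eq_le scale_int_le1//= -LL' -[leRHS]mule1.
by rewrite lee_wpmul2l ?scale_ge0// scale_int_le1.
Qed.

(** The preimage of the cube is the box whose i-th side runs from 0, included, to 1 / d_i, excluded,
    on whichever side of 0 this lies. *)
Lemma scale_diag n (d : 'rV[int]_n) : (forall i, d 0 i != 0) ->
  scale (intmx (diag_mx d)) = (\prod_i `|d 0 i|%:~R^-1)%:E.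
Proof.
move=> d0; rewrite /scale.
rewrite (_ : [set _ | _] = [set x | forall i,
    [set y : R | (d 0 i)%:~R * y \in `[0, 1[] (tnth x i)]).
  have leb_i i : leb [set y : R | (d 0 i)%:~R * y \in `[0, 1[] =
      (`|d 0 i|%:~R^-1)%:E /\
      measurable [set y : R | (d 0 i)%:~R * y \in `[0, 1[].
    have := d0 i; set a := d 0 i; rewrite -(intr_eq0 R) => a0.
    have [a_gt0|a_lt0|a_eq0] := ltgtP a 0.
    - have aR : (a%:~R : R) < 0 by rewrite ltrz0.
      rewrite (_ : [set _ | _] = `]a%:~R^-1, 0]%classic).
        by rewrite leb_itv ?invr_le0 ?ltW// sub0r ltr0_norm// rmorphN/= invrN.
      apply/seteqP; split => y /=; rewrite !in_itv/=.
        move=> /andP[y0 y1]; apply/andP; split.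
          by rewrite -[ltLHS]mul1r ltr_ndivrMr// mulrC.
        by rewrite -(nmulr_rge0 _ aR).
      move=> /andP[y0 y1]; rewrite nmulr_rge0// y1/=.
      by rewrite mulrC -ltr_ndivrMr// mul1r.
    - have aR : 0 < (a%:~R : R) by rewrite ltr0z.
      rewrite (_ : [set _ | _] = `[0, a%:~R^-1[%classic).
        by rewrite leb_itv ?invr_ge0 ?ltW// subr0 gtr0_norm.
      apply/seteqP; split => y /=; rewrite !in_itv/=.
        by rewrite pmulr_rge0// -[a%:~R^-1]mul1r ltr_pdivlMr// mulrC.
      by rewrite pmulr_rge0// -[a%:~R^-1]mul1r ltr_pdivlMr// mulrC.
    - by move: a0; rewrite a_eq0 eqxx.
  rewrite (lebn_box (B := fun i => [set y : R | (d 0 i)%:~R * y \in `[0, 1[]));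
    last by move=> i; have [] := leb_i i.
  by rewrite -prodEFin; apply: eq_bigr => i _; have [] := leb_i i.
have E x i : tnth (tcol (intmx (diag_mx d) *m colt x)) i = (d 0 i)%:~R * tnth x i.
  rewrite tnth_tcol mxE (bigD1 i)//= big1 => [|j ji].
    by rewrite !mxE eqxx mulr1n addr0.
  by rewrite !mxE eq_sym (negPf ji) mulr0n mulr0z mul0r.
by apply/seteqP; split => x /= h i; have := h i; rewrite E.
Qed.

(** In the Smith normal form L D N the unimodular factors have scale 1 and determinant 1 or -1,
    which leaves the diagonal D. *)
Lemma scale_int n (M : 'M[int]_n) : \det M != 0 ->
  scale (intmx M) = (`|\det M|%:~R^-1)%:E.
Proof.
have [L uL [N uN [d _ ->]]] := int_Smith_normal_form M.
have -> : (\matrix_(i < n, j < n) (d`_i *+ (i == j :> nat))) =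
    diag_mx (\row_(i < n) d`_i).
  by apply/matrixP => i j; rewrite !mxE.
rewrite !det_mulmx !mulf_eq0 !negb_or => /andP[/andP[L0 D0] N0].
have absdet (K : 'M[int]_n) : K \in unitmx -> `|\det K| = 1.
  by rewrite unitmxE => /orP[] /eqP ->; rewrite ?normrN normr1.
set D := diag_mx _ in D0 *.
have -> : intmx (L *m D *m N) = intmx L *m intmx D *m intmx N.
  by rewrite !map_mxM.
rewrite !scaleM ?unitmx_mul ?unitmx_int//.
rewrite (scale_unimodular uL) (scale_unimodular uN) mul1e mule1 {1}/D scale_diag; last first.
  move=> i; apply: contraNN D0 => /eqP di; rewrite det_diag.
  by rewrite (bigD1 i)//= di mul0r.
rewrite !normrM (absdet _ uL) (absdet _ uN) mul1r mulr1 det_diag normr_prod.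
by rewrite rmorph_prod/= prodfV.
Qed.

End integer_matrices.

(** * Faces of boxes *)

Section box_vertex.
Context {R : realFieldType} {r n : nat} (B : 'M[R]_(r, n)).

(** Linear independence of the columns of B indexed by S, stated through kernel vectors so that no
    submatrix has to be formed. *)
Definition indep_cols (S : {set 'I_n}) : Prop := forall u : 'cV[R]_n,
  B *m u = 0 -> (forall j, j \notin S -> u j 0 = 0) -> u = 0.

Lemma rank_ker0 p q (C : 'M[R]_(p, q)) :
  (forall v : 'cV[R]_q, C *m v = 0 -> v = 0) -> \rank C = q.
Proof.
move=> C0; rewrite -mxrank_tr; apply/eqP/inj_row_free => v /(congr1 trmx).
rewrite trmx_mul trmxK trmx0 => /C0 /(congr1 trmx).
by rewrite trmxK trmx0.
Qed.

(** [colsub s 1%:M] extends a vector along s by zeros; multiplying B by it selects the columns of B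
    listed by s. *)
Lemma colsub1_mul p (s : 'I_p -> 'I_n) (v : 'cV[R]_p) i : injective s ->
  (colsub s 1%:M *m v) (s i) 0 = v i 0.
Proof.
move=> s_inj; rewrite mxE (bigD1 i)//= !mxE eqxx mul1r big1 ?addr0// => j ji.
by rewrite !mxE (inj_eq s_inj) eq_sym (negPf ji) mul0r.
Qed.

Lemma colsub1_mul0 p (s : 'I_p -> 'I_n) (v : 'cV[R]_p) j :
  (forall i, s i != j) -> (colsub s 1%:M *m v) j 0 = 0.
Proof.
move=> sj; rewrite mxE big1// => i _.
by rewrite !mxE eq_sym (negPf (sj i)) mul0r.
Qed.

(** A kernel vector of the submatrix, extended by zeros, is a kernel vector of B supported in S,
    hence zero. *)
Lemma colsub_unit (S : {set 'I_n}) (s : 'I_r -> 'I_n) : indep_cols S ->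
  injective s -> (forall i, s i \in S) -> colsub s B \in unitmx.
Proof.
move=> iS s_inj sS; rewrite -row_free_unit; apply/eqP/rank_ker0 => v.
rewrite -[B]mulmx1 -mulmx_colsub -mulmxA => /iS v0; apply/colP => i.
rewrite -(colsub1_mul v i s_inj) v0 ?mxE// => j jS.
by apply: colsub1_mul0 => i'; apply: contraNneq jS => <-.
Qed.

(** A maximal independent set of columns spans the column space of B, which has dimension r because
    the rows of B are independent. *)
Lemma indep_cols_card (S : {set 'I_n}) : row_free B -> indep_cols S ->
  (forall S' : {set 'I_n}, S \subset S' -> indep_cols S' -> S' = S) -> #|S| = r.
Proof.
move=> fB iS maxS; pose e : 'I_#|S| -> 'I_n := enum_val.
pose C := B *m colsub e 1%:M.
have supp (v : 'cV[R]_#|S|) j : j \notin S -> (colsub e 1%:M *m v) j 0 = 0.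
  move=> jS; apply: colsub1_mul0 => i.
  by apply: contraNneq jS => <-; exact: enum_valP.
have rC : \rank C = #|S|.
  apply: rank_ker0 => v; rewrite -mulmxA => /iS v0; apply/colP => i.
  by rewrite -(colsub1_mul v i enum_val_inj) v0 ?mxE//; exact: supp.
have colC j : exists w : 'cV_#|S|, col j B = C *m w.
  have wS (u : 'cV[R]_n) : (forall j, j \notin S -> u j 0 = 0) ->
      u = colsub e 1%:M *m (\col_i u (e i) 0).
    move=> u0; apply/colP => l; have [lS|lS] := boolP (l \in S); last first.
      by rewrite u0// supp.
    rewrite -[l](enum_rankK_in lS lS) colsub1_mul ?mxE//; exact: enum_val_inj.
  have [jS|jS] := boolP (j \in S).
    exists (\col_i (delta_mx j 0 : 'cV[R]_n) (e i) 0).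
    rewrite -mulmxA -wS; first by rewrite colE.
    by move=> l lS; rewrite mxE; case: eqP lS jS => // -> /negPf ->.
  have : ~ indep_cols (j |: S).
    move=> /(maxS _ (finset.subsetUr _ _)) /setP /(_ j).
    by rewrite !inE eqxx (negPf jS).
  move=> /existsNP[u /not_implyP[Bu /not_implyP[u0 /eqP un0]]].
  have uj : u j 0 != 0.
    apply: contraNneq un0 => uj; apply/eqP/iS => // l lS.
    have [->//|lj] := eqVneq l j; apply: u0.
    by rewrite !inE negb_or lj.
  (* Maximality of S yields a relation u between column j and the columns in S with nonzero j-th
     entry; solving it for column j gives a combination supported in S. *)
  pose u' : 'cV[R]_n := delta_mx j 0 - (u j 0)^-1 *: u.
  exists (\col_i u' (e i) 0); rewrite -mulmxA -wS.
    by rewrite mulmxBr -colE -scalemxAr Bu scaler0 subr0.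
  move=> l lS; rewrite !mxE eqxx andbT.
  have [->|lj] := eqVneq l j; first by rewrite mulVf// subrr.
  by rewrite (u0 l) ?mulr0 ?subr0// !inE negb_or lj.
apply/eqP; rewrite eqn_leq -{1}rC rank_leq_row/=.
have <- : \rank B = r by apply/eqP.
rewrite -rC -mxrank_tr -(mxrank_tr C); apply: mxrankS; apply/row_subP => j.
have [w jw] := colC j.
by rewrite -tr_col jw trmx_mul submxMl.
Qed.

(* As long as the columns of the non-endpoint coordinates are dependent, x can be
   moved along a kernel vector supported there until it hits a new endpoint. *)
Lemma box_vertex (a b : 'I_n -> R) (x : 'cV[R]_n) : row_free B ->
  (forall j, a j <= x j 0 <= b j) ->
  exists (S : {set 'I_n}) (x' : 'cV[R]_n), [/\ #|S| = r, indep_cols S, B *m x' = B *m x,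
    (forall j, a j <= x' j 0 <= b j) &
    forall j, j \notin S -> x' j 0 = a j \/ x' j 0 = b j].
Proof.
move=> fB.
pose F (x : 'cV[R]_n) := [set j | (x j 0 != a j) && (x j 0 != b j)]%SET.
have [N] := ubnP #|F x|; elim: N x => // N IH x xN xab.
have [iF|] := pselect (indep_cols (F x)).
  (* When the columns at the non-endpoint coordinates are independent, their index set is enlarged
     to a maximal independent S; the coordinates outside S are then endpoints. *)
  have [S /maxsetP[/asboolP iS Smax] FS] :=
    @maxset_exists _ (fun S => `[< indep_cols S >]) (F x) (asboolT iF).
  exists S, x; split=> //.
    by apply: indep_cols_card => // S' SS' iS'; apply: Smax => //; exact/asboolP.
  move=> j jS; have : j \notin F x by apply: contra jS; exact: (fintype.subsetP FS).
  by rewrite inE negb_and !negbK => /orP[] /eqP; [left|right].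
move=> /existsNP[u /not_implyP[Bu /not_implyP[u0 /eqP un0]]].
have [j0 uj0] : exists j, u j 0 != 0.
  apply/existsP; apply: contraNT un0 => /existsPn un0.
  by apply/eqP/colP => j; rewrite mxE; apply/eqP; move: (un0 j); rewrite negbK.
(* Moving along u, coordinate j reaches the endpoint ahead of it at time [tau j]; stopping at the
   least such time stays in the box. *)
pose tau j := ((if 0 < u j 0 then b j else a j) - x j 0) / u j 0.
case: (@Order.TotalTheory.arg_minP _ _ _ j0 (fun j => u j 0 != 0) tau uj0) => j uj jmin.
have uF l : u l 0 != 0 -> l \in F x by apply: contraNT => /u0 ->.
have tau_ge0 l : u l 0 != 0 -> 0 <= tau l.
  move=> ul; have /andP[al bl] := xab l; rewrite /tau.
  have [ul0|ul0|ul0] := ltgtP 0 (u l 0).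
  - by rewrite divr_ge0 ?subr_ge0// ltW.
  - by rewrite mulr_le0 ?invr_le0 ?subr_le0// ltW.
  - by move: ul; rewrite -ul0 eqxx.
pose y := x + tau j *: u.
have yE l : y l 0 = x l 0 + tau j * u l 0 by rewrite !mxE.
have yab l : a l <= y l 0 <= b l.
  have /andP[al bl] := xab l; rewrite yE.
  have [->|ul] := eqVneq (u l 0) 0; first by rewrite mulr0 addr0 al.
  have tj0 := tau_ge0 _ uj.
  have := jmin l ul; rewrite {2}/tau.
  have [ul0|ul0|ul0] := ltgtP 0 (u l 0); last by move: ul; rewrite -ul0 eqxx.
    have : 0 <= tau j * u l 0 by rewrite mulr_ge0// ltW.
    by rewrite ler_pdivlMr// => ? ?; apply/andP; split; lra.
  have : tau j * u l 0 <= 0 by rewrite mulr_ge0_le0// ltW.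
  by rewrite ler_ndivlMr// => ? ?; apply/andP; split; lra.
have yj : y j 0 = a j \/ y j 0 = b j.
  rewrite yE /tau divfK//; case: ifP => _; [right|left]; lra.
(* u vanishes off [F x], so no coordinate leaves its endpoint, while coordinate j arrives at one. *)
have Fy : (#|F y| < #|F x|)%N.
  apply: proper_card; apply/properP; split.
    apply/fintype.subsetP => l; apply: contraTT => lF.
    have ul : u l 0 = 0 by exact: u0.
    by move: lF; rewrite !inE yE ul mulr0 addr0.
  exists j; first exact: uF.
  by rewrite inE; case: yj => ->; rewrite eqxx ?andbF.
have [S [x' [cS iS Bx' x'ab x'S]]] := IH y (leq_trans Fy xN) yab.
exists S, x'; split => //.
by rewrite Bx' mulmxDr -scalemxAr Bu scaler0 addr0.
Qed.

End box_vertex.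

(** The Leibniz formula has r! terms, each of absolute value at most 1. *)
Lemma norm_det_le_fact r (M : 'M[int]_r) :
  (forall i j, `|M i j| <= 1) -> `|\det M| <= (r`!)%:R.
Proof.
move=> M1; apply: (le_trans (ler_norm_sum _ _ _)).
have -> : (r`!)%:R = \sum_(s : 'S_r) 1 :> int by rewrite sumr_const card_Sn.
apply: ler_sum => s _.
rewrite normrM normrX normrN1 expr1n mul1r normr_prod.
by apply: prodr_ile1 => i _; rewrite normr_ge0 M1.
Qed.

Lemma measure_bigsetU_le d (T : measurableType d) (R : realType)
    (mu : {measure set T -> \bar R}) (I : Type) (s : seq I) (Q : pred I)
    (F : I -> set T) : (forall i, Q i -> measurable (F i)) ->
  (mu (\big[setU/set0]_(i <- s | Q i) F i) <= \sum_(i <- s | Q i) mu (F i))%E.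
Proof.
move=> mF; pose P A (x : \bar R) := measurable A /\ (mu A <= x)%E.
suff [] : P (\big[setU/set0]_(i <- s | Q i) F i) (\sum_(i <- s | Q i) mu (F i))%E by [].
apply: (big_ind2 P) => [|A x B y [mA Ax] [mB By]|i Qi].
- by split => //; rewrite measure0.
- split; first exact: measurableU.
  by apply: (le_trans (measureU2 _ mA mB)); exact: leeD.
- by split => //; exact: mF.
Qed.

(** * Covering the image of a box by images of its faces *)

Section image_box.
Context {R : realType}.

Local Notation intmx M := (map_mx (intr : int -> R) M).

(** [F] is the image of the box under x |-> M x + w, written as a preimage under the inverse; the
    scales of M and its inverse multiply to 1, so the inverse has scale |det M|. *)
Lemma lebn_invmx_box r (M : 'M[int]_r) (w : 'cV[R]_r) (a b : 'I_r -> R) :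
  \det M != 0 -> (forall i, a i <= b i) ->
  let F := [set y | forall i,
    tnth (tcol (invmx (intmx M) *m (colt y - w))) i \in `[a i, b i] ] in
  measurable F /\
  lebn r F = (`|\det M|%:~R * \prod_i (b i - a i))%:E.
Proof.
move=> M0 ab F; set N := invmx (intmx M).
have uM : intmx M \in unitmx by exact: unitmx_int.
have uN : N \in unitmx by rewrite unitmx_inv.
pose K := [set x : r.-tuple R | forall i, tnth x i \in `[a i, b i] ].
have mK : measurable K by exact: (measurable_box (B := fun i => `[a i, b i]%classic)).
have mNK := measurable_preimage_mulmx N mK.
have FE : F = [set y | [set z | K (tcol (N *m colt z))] (tcol (colt y - w))].
  by apply/seteqP; split => y; rewrite /F/K/= tcolK.
split.
  rewrite FE -[X in measurable X]setTI.
  exact: (measurable_translation (- w)).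
rewrite FE lebn_translation// lebn_mulmx//.
rewrite (lebn_box (B := fun i => `[a i, b i]%classic))//.
rewrite (eq_bigr (fun i => (b i - a i)%:E)); last by move=> i _; rewrite leb_itv.
rewrite prodEFin mulrC EFinM; congr (_ * _)%E.
have d0 : (`|\det M|%:~R : R) != 0 by rewrite intr_eq0 normr_eq0.
have := scaleM uN uM; rewrite mulVmx// scale1 scale_int//.
move=> /(congr1 (fun x => x * (`|\det M|%:~R)%:E)%E).
by rewrite mul1e -muleA -EFinM mulVf// mule1.
Qed.

(* [S] is the set of free coordinates of a face and [U], in the proof, the set of
   the other coordinates that sit at their upper endpoint. *)
Lemma lebn_image_box r k (M : 'M[int]_(r, r + k)) (a b : 'I_(r + k) -> R) :
  (forall i j, `|M i j| <= 1) -> row_free (intmx M) ->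
  (forall j, a j <= b j) ->
  exists W : set (r.-tuple R), [/\ measurable W,
    forall x : 'cV[R]_(r + k), (forall j, a j <= x j 0 <= b j) -> W (tcol (intmx M *m x)) &
    (lebn r W <= (\sum_(S : {set 'I_(r + k)} | #|S| == r)
       (2 ^ k * r`!)%:R * \prod_(j in S) (b j - a j))%:E)%E].
Proof.
move=> M1 fM ab.
(* [sel S] enumerates S when it has r elements; [lshift k] is a default for the other sets. *)
have /boolp.choice[sel selP] : forall S : {set 'I_(r + k)},
    exists s : 'I_r -> 'I_(r + k),
      #|S| = r -> injective s /\ S = [set s i | i in 'I_r]%SET.
  move=> S.
  have [cS|cS] := eqVneq #|S| r; last by exists (lshift k) => /eqP; rewrite (negPf cS).
  exists (fun i => enum_val (cast_ord (esym cS) i)) => _; split.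
    by move=> i j /enum_val_inj /cast_ord_inj.
  apply/setP => j; apply/idP/imsetP => [jS|[i _ ->]]; last exact: enum_valP.
  by exists (cast_ord cS (enum_rank_in jS j)); rewrite // cast_ordK enum_rankK_in.
(* [c S U] holds the fixed coordinates of a face and 0 at the free ones. *)
pose c (S U : {set 'I_(r + k)}) : 'cV[R]_(r + k) :=
  \col_j (if j \in S then 0 else if j \in U then b j else a j).
pose N S := colsub (sel S) M.
(* The image of the face. A face whose free columns are dependent is dropped, which loses nothing
   since [box_vertex] returns independent columns. *)
pose F S (U : {set 'I_(r + k)}) : set (r.-tuple R) := if \det (N S) == 0 then set0 else
  [set y | forall i, tnth (tcol (invmx (intmx (N S)) *m
     (colt y - intmx M *m c S U))) i \in `[a (sel S i), b (sel S i)] ].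
have FP (S U : {set 'I_(r + k)}) : #|S| = r -> measurable (F S U) /\
    (lebn r (F S U) <= (r`!%:R * \prod_(j in S) (b j - a j))%:E)%E.
  move=> cS; have [sinj SE] := selP _ cS.
  have -> : \prod_(j in S) (b j - a j) = \prod_i (b (sel S i) - a (sel S i)).
    by rewrite [in LHS]SE big_imset//= => i j _ _; exact: sinj.
  have p0 : 0 <= \prod_i (b (sel S i) - a (sel S i)).
    by apply: prodr_ge0 => i _; rewrite subr_ge0.
  rewrite /F; case: eqP => [_|/eqP N0].
    by split => //; rewrite measure0 lee_fin mulr_ge0.
  have [|mF ->] := lebn_invmx_box (intmx M *m c S U)
    (a := fun i => a (sel S i)) (b := fun i => b (sel S i)) N0.
    by [].
  split => //; rewrite lee_fin ler_wpM2r//.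
  rewrite pmulrn ler_int -natz; apply: norm_det_le_fact => i j.
  by rewrite mxE M1.
exists (\big[setU/set0]_(S : {set 'I_(r + k)} | #|S| == r)
  \big[setU/set0]_(U | U \in powerset (~: S)) F S U).
have mFF (S : {set 'I_(r + k)}) : #|S| == r ->
    measurable (\big[setU/set0]_(U in powerset (~: S)) F S U).
  by move=> /eqP cS; apply: bigsetU_measurable => U _; have [] := FP S U cS.
split.
- exact: bigsetU_measurable.
- move=> x xab; have [S [x' [cS iS Bx' x'ab x'S]]] := box_vertex fM xab.
  rewrite -bigcup_seq_cond; exists S; first by rewrite /= mem_index_enum cS eqxx.
  pose U := [set j in ~: S | x' j 0 == b j]%SET.
  rewrite -bigcup_seq_cond; exists U.
    rewrite /= mem_index_enum powersetE/=.
    by apply/fintype.subsetP => j; rewrite inE => /andP[].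
  have [sinj SE] := selP _ cS.
  have sS i : sel S i \in [set sel S i | i in 'I_r]%SET by exact: imset_f.
  rewrite -SE in sS.
  have uN := colsub_unit iS sinj sS; rewrite -map_mxsub in uN.
  have N0 : \det (N S) != 0.
    by move: uN; rewrite unitmxE -/(N S) det_map_mx unitfE intr_eq0.
  rewrite /F (negPf N0) => i.
  suff -> : invmx (intmx (N S)) *m (colt (tcol (intmx M *m x)) -
      intmx M *m c S U) = \col_i x' (sel S i) 0.
    by rewrite tnth_tcol mxE in_itv/=.
  (* Subtracting [c S U] from x' leaves its free coordinates extended by zeros, so M maps the
     difference to [N S] times these coordinates. *)
  apply: (canLR (mulKmx uN)); rewrite tcolK -Bx' -mulmxBr.
  rewrite /N map_mxsub -[in RHS](mulmx1 (intmx M)) -mulmx_colsub -mulmxA.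
  congr (_ *m _); apply/colP => j; rewrite !mxE.
  have [jS|jS] := boolP (j \in S).
    have /imsetP[l _ ->] : j \in [set sel S i | i in 'I_r]%SET by rewrite -SE.
    have := colsub1_mul (\col_i x' (sel S i) 0) l sinj.
    by rewrite [X in X = _ -> _]mxE mxE subr0 => ->.
  have : (colsub (sel S) 1%:M *m \col_i x' (sel S i) 0) j 0 = 0.
    by apply: colsub1_mul0 => l; apply: contraNneq jS => <-.
  rewrite mxE => ->.
  rewrite !inE jS/=; case: eqP => [->|xb]; first by rewrite subrr.
  by have [->|//] := x'S j jS; rewrite subrr.
- apply: (le_trans (measure_bigsetU_le _ _ mFF)).
  rewrite -sumEFin; apply: lee_sum => S cS.
  apply: (@le_trans _ _ (\sum_(U in powerset (~: S)) lebn r (F S U))%E).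
    by apply: measure_bigsetU_le => U _; have [] := FP S U (eqP cS).
  apply: (@le_trans _ _ (\sum_(U in powerset (~: S)) (r`!%:R * \prod_(j in S) (b j - a j))%:E)%E).
    by apply: lee_sum => U _; have [] := FP S U (eqP cS).
  (* The complement of S has k elements, hence 2^k choices of U. *)
  rewrite sumEFin lee_fin sumr_const card_powerset.
  have -> : #|~: S| = k.
    by apply/(@addnI #|S|); rewrite cardsC card_ord (eqP cS).
  by rewrite natrM -mulrA -[leLHS]mulr_natl.
Qed.

End image_box.

(** * Volume of the event *)

(** While the rank is below n, some unit row lies outside the row space, and adding it raises the
    rank by one. *)
Lemma unit_rows_completion (F : fieldType) n p s (V : 'M[F]_(p, n)) :
  (\rank V + s)%N = n ->
  exists g : 'I_s -> 'I_n, row_full (col_mx V (rowsub g 1%:M)).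
Proof.
elim: s p V => [|s IH] p V rV.
  have g : 'I_0 -> 'I_n by case.
  exists g; rewrite -sub1mx -addsmxE; apply: (submx_trans _ (addsmxSl _ _)).
  by rewrite sub1mx /row_full; apply/eqP; rewrite -[RHS]rV addn0.
have [j jV] : exists j, ~~ (row j 1%:M <= V)%MS.
  apply/existsP; apply: contraT => /existsPn V1.
  have : (1%:M <= V)%MS by apply/row_subP => i; move: (V1 i); rewrite negbK.
  by rewrite sub1mx /row_full => /eqP V1'; move: rV; rewrite V1'; lia.
have rV' : \rank (col_mx V (row j 1%:M)) = (\rank V).+1.
  rewrite -addsmxE; apply/eqP; rewrite eqn_leq; apply/andP; split.
    apply: (leq_trans (mxrank_adds_leqif _ _)).
    by rewrite -[leqRHS]addn1 leq_add2l rank_leq_row.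
  apply: rank_ltmx; rewrite ltmxE addsmxSl/=; apply: contra jV.
  by apply: submx_trans; exact: addsmxSr.
have [|g fg] := IH _ (col_mx V (row j 1%:M)); first by rewrite rV' addSnnS.
exists (fun i => if unlift ord0 i is Some i' then g i' else j).
set h := (fun _ => _); move: fg; rewrite -!sub1mx => /submx_trans; apply.
rewrite !col_mx_sub -!addsmxE addsmxSl/=; apply/andP; split.
  apply: submx_trans (addsmxSr _ _).
  by have := row_sub ord0 (rowsub h (1%:M : 'M[F]_n)); rewrite row_rowsub /h unlift_none.
apply: submx_trans (addsmxSr _ _); apply/row_subP => i.
by have := row_sub (lift ord0 i) (rowsub h (1%:M : 'M[F]_n)); rewrite !row_rowsub /h liftK.
Qed.

Section volume.
Context {R : realType}.

Local Notation intmx M := (map_mx (intr : int -> R) M).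

Lemma lebn_hypercube k (eps : R) (H : set (k.-tuple R)) : 0 <= eps ->
  is_hypercube eps H -> lebn k H = (eps ^+ k)%:E.
Proof.
move=> eps0 [a [l [r ->]]].
rewrite (lebn_box (B := fun j => [set` Interval (BSide (l j) (tnth a j))
   (BSide (r j) (tnth a j + eps))])); last by move=> i; exact: measurable_itv.
rewrite (eq_bigr (fun=> eps%:E)) ?prodEFin ?prodr_const ?card_ord// => j _.
by rewrite leb_itv ?lerDl//; congr (_%:E); ring.
Qed.

Definition fst_tuple r k (u : (r + k).-tuple R) : r.-tuple R :=
  [tuple tnth u (lshift k i) | i < r].
Definition snd_tuple r k (u : (r + k).-tuple R) : k.-tuple R :=
  [tuple tnth u (rshift r i) | i < k].

Lemma measurable_fst_tuple r k : measurable_fun setT (@fst_tuple r k).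
Proof.
apply/measurable_fun_tnthP => i.
rewrite (_ : _ \o _ = (fun u => tnth u (lshift k i))).
  exact: measurable_tnth.
by apply/funext => u /=; rewrite tnth_mktuple.
Qed.

Lemma measurable_snd_tuple r k : measurable_fun setT (@snd_tuple r k).
Proof.
apply/measurable_fun_tnthP => i.
rewrite (_ : _ \o _ = (fun u => tnth u (rshift r i))).
  exact: measurable_tnth.
by apply/funext => u /=; rewrite tnth_mktuple.
Qed.

Lemma fst_tuple_cat r k (y : r.-tuple R) (z : k.-tuple R) :
  fst_tuple [tuple of y ++ z] = y.
Proof. by apply/eq_from_tnth => i; rewrite tnth_mktuple tnth_lshift. Qed.

Lemma snd_tuple_cat r k (y : r.-tuple R) (z : k.-tuple R) :
  snd_tuple [tuple of y ++ z] = z.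
Proof. by apply/eq_from_tnth => i; rewrite tnth_mktuple tnth_rshift. Qed.

Lemma fst_tuple_col_mx r k (y : 'cV[R]_r) (z : 'cV[R]_k) :
  fst_tuple (tcol (col_mx y z)) = tcol y.
Proof.
by apply/eq_from_tnth => i; rewrite !(tnth_mktuple, tnth_tcol) col_mxEu.
Qed.

Lemma snd_tuple_col_mx r k (y : 'cV[R]_r) (z : 'cV[R]_k) :
  snd_tuple (tcol (col_mx y z)) = tcol z.
Proof.
by apply/eq_from_tnth => i; rewrite !(tnth_mktuple, tnth_tcol) col_mxEd.
Qed.

Section event.
Variables (r k : nat) (B : 'M[int]_(r, r + k)) (D : 'M[int]_(k, r + k)).
Variables (eps : R) (C : r.-tuple R -> set (k.-tuple R)).
Hypothesis eps0 : 0 <= eps.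
Hypothesis hC : forall y, is_hypercube eps (C y).
Hypothesis mC : measurable [set p : r.-tuple R * k.-tuple R | C p.1 p.2].
Hypothesis BD0 : \det (col_mx B D) != 0.

Definition event (x : (r + k).-tuple R) :=
  C (tcol (intmx B *m colt x)) (tcol (intmx D *m colt x)).

Let V (W : set (r.-tuple R)) : set ((r + k).-tuple R) :=
  [set u | W (fst_tuple u) /\ C (fst_tuple u) (snd_tuple u)].

Let mV W : measurable W -> measurable (V W).
Proof.
move=> mW; apply: measurableI.
  rewrite -[X in measurable X]setTI.
  exact: (measurable_fst_tuple measurableT).
have := measurable_fun_pair (@measurable_fst_tuple r k) (@measurable_snd_tuple r k).
by move=> /(_ measurableT _ mC); rewrite setTI.
Qed.

Let VE W x : V W (tcol (intmx (col_mx B D) *m colt x)) =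
  (W (tcol (intmx B *m colt x)) /\ event x).
Proof.
by rewrite /V/= map_col_mx mul_col_mx fst_tuple_col_mx snd_tuple_col_mx.
Qed.

Lemma measurable_event : measurable event.
Proof.
have := measurable_preimage_mulmx (intmx (col_mx B D)) (mV measurableT).
under eq_set do rewrite VE.
by congr measurable; apply/seteqP; split => x // [].
Qed.

(** The points of J in the event lie in the preimage of [V W] under the stacked matrix, whose scale
    is at most 1; the slices of [V W] at y in W are hypercubes of volume eps^k. *)
Lemma lebn_event_le (W : set (r.-tuple R)) (J : set ((r + k).-tuple R)) :
  measurable W -> measurable J ->
  (forall x, J x -> W (tcol (intmx B *m colt x))) ->
  (lebn (r + k) [set x | J x /\ event x] <= (eps ^+ k)%:E * lebn r W)%E.
Proof.
move=> mW mJ JW.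
have mVN := measurable_preimage_mulmx (intmx (col_mx B D)) (mV mW).
apply: (@le_trans _ _
    (lebn (r + k) [set x | V W (tcol (intmx (col_mx B D) *m colt x))])).
  apply: le_measure; rewrite ?inE//.
    by apply: measurableI => //; exact: measurable_event.
  by move=> x [Jx Ex] /=; rewrite VE; split => //; exact: JW.
rewrite lebn_mulmx//; [|exact: unitmx_int|exact: mV].
apply: (@le_trans _ _ (lebn (r + k) (V W) * 1)%E).
  by rewrite lee_wpmul2l ?scale_int_le1.
rewrite mule1 lebn_cat; last exact: mV.
rewrite product_measureE muleC -integral_indicZ//; last first.
  by rewrite lee_fin exprn_ge0.
rewrite [leLHS](eq_integral (fun y => (\1_W y)%:E * (eps ^+ k)%:E)%E) => [//|y _].
rewrite -(lebn_hypercube eps0 (hC y)) -measure_guard; congr (lebn k _).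
by apply/seteqP; split => z; rewrite /V/= fst_tuple_cat snd_tuple_cat.
Qed.

End event.

End volume.

(** * Joint law of independent variables *)

Section subgraph.
Context {R : realType} (g : R -> R).
Hypothesis mg : measurable_fun setT g.
Hypothesis g0 : forall x, 0 <= g x.

(** The level t comes first and the point x second: for t >= 0 the section at t is the superlevel
    set {g > t}, and the section at x has length g x. *)
Definition subgraph : set (R * R) := [set q | q.1 \in `[0, g q.2[ ].

Lemma measurable_subgraph : measurable subgraph.
Proof.
rewrite (_ : subgraph = [set q | 0 <= q.1] `&` [set q | q.1 < g q.2]).
  apply: measurableI.
    rewrite -[X in measurable X]setTI.
    have : measurable_fun setT (fun q : R * R => 0 <= q.1).
      by apply: measurable_fun_ler => //; exact: measurable_fst.
    by move=> /(_ measurableT [set true]); rewrite setTI; apply.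
  rewrite -[X in measurable X]setTI.
  have : measurable_fun setT (fun q : R * R => q.1 < g q.2).
    apply: measurable_fun_ltr; first exact: measurable_fst.
    by apply: measurableT_comp => //; exact: measurable_snd.
  by move=> /(_ measurableT [set true]); rewrite setTI; apply.
by apply/seteqP; split => q; rewrite /subgraph/= in_itv/= => /andP.
Qed.

Lemma leb_subgraph x : leb [set t | subgraph (t, x)] = (g x)%:E.
Proof.
rewrite (_ : [set t | _] = `[0, g x[%classic)//.
by rewrite leb_itv// subr0.
Qed.

End subgraph.

Section law.
Context d (T : measurableType d) (R : realType) (P : probability T R) (n : nat).
Variables (X : 'I_n -> {RV P >-> R}) (g : 'I_n -> R -> R).
Hypothesis hindep : mutually_independent X.
Hypothesis mg : forall i, measurable_fun setT (g i).
Hypothesis g0 : forall i x, 0 <= g i x.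
Hypothesis hg : forall i (B : set R), measurable B ->
  P (X i @^-1` B) = (\int[leb]_x (\1_B x * g i x)%:E)%E.

Definition joint (w : T) : n.-tuple R := [tuple X i w | i < n].

Lemma measurable_joint : measurable_fun setT joint.
Proof.
apply/measurable_fun_tnthP => i.
rewrite (_ : _ \o _ = X i); first exact: measurable_funP.
by apply/funext => w /=; rewrite tnth_mktuple.
Qed.

Definition subgraphs : set (n.-tuple R * n.-tuple R) :=
  [set q | forall j, subgraph (g j) (tnth q.1 j, tnth q.2 j)].

Lemma measurable_subgraphs : measurable subgraphs.
Proof.
rewrite (_ : subgraphs = \bigcap_(j in [set: 'I_n])
    ((fun q => (tnth q.1 j, tnth q.2 j)) @^-1` subgraph (g j))); last first.
  by apply/seteqP; split => q /= h j; [move=> _|]; exact: h.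
apply: fin_bigcap_measurable => // j _.
rewrite -[X in measurable X]setTI.
have : measurable_fun setT
    (fun q : n.-tuple R * n.-tuple R => (tnth q.1 j, tnth q.2 j)).
  apply: measurable_fun_pair.
    by apply: (measurableT_comp (measurable_tnth j)); exact: measurable_fst.
  by apply: (measurableT_comp (measurable_tnth j)); exact: measurable_snd.
by apply => //; exact: measurable_subgraph.
Qed.

(** Both sides are measures in E. On a box the left one factors by independence; on the right,
    Tonelli integrates over t first, and for x in the box the admissible t form a box with sides [0,
    g_j(x_j)[. *)
Lemma joint_law (E : set (n.-tuple R)) : measurable E ->
  P [set w | E (joint w)] =
  (\int[lebn n]_t lebn n [set x | subgraphs (t, x) /\ E x])%E.
Proof.
have mJ := measurable_joint; have mS := measurable_subgraphs.
(* Lebesgue measure on pairs (t, x) restricted to the subgraphs; its image under (t, x) |-> x has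
   the product of the g_i as density. *)
pose m2 := mrestr (lebn n \x lebn n)%E mS.
have ms : measurable_fun setT (@snd (n.-tuple R) (n.-tuple R)).
  exact: measurable_snd.
have mSE A : measurable A ->
    measurable [set q : n.-tuple R * n.-tuple R | subgraphs q /\ A q.2].
  by move=> mA; apply: measurableI => //; rewrite -[X in measurable X]setTI; exact: ms.
have m2E A : pushforward m2 snd A =
    (\int[lebn n]_t lebn n [set x | subgraphs (t, x) /\ A x])%E.
  rewrite /pushforward /m2 /mrestr product_measureE; apply: eq_integral => t _.
  by congr (lebn n _); apply/seteqP; split => x /= [].
move=> mE; rewrite -m2E; move: E mE.
apply: (@measure_box_unique _ _ (pushforward P joint) (pushforward m2 snd)) => //.
- move=> B mB; pose Box := [set x | forall i, B i (tnth x i)].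
  have mBox : measurable Box by exact: measurable_box.
  transitivity (\prod_(i < n) P (X i @^-1` B i))%E.
    transitivity (\prod_(i in [set: 'I_n]%SET) P (X i @^-1` B i))%E; last first.
      by apply: eq_bigl => i; rewrite inE.
    rewrite -hindep//; congr (P _); apply/seteqP; split => w /=.
      by move=> h i _; have := h i; rewrite tnth_mktuple.
    by move=> h i; rewrite tnth_mktuple; apply: h; rewrite /= inE.
  transitivity (\int[lebn n]_t lebn n [set x | subgraphs (t, x) /\ Box x])%E;
    last by rewrite -m2E.
  rewrite (tonelli_sections (lebn n) (lebn n) (mSE _ mBox))/=.
  transitivity (\int[lebn n]_x
      \prod_(i < n) (\1_(B i) (tnth x i) * g i (tnth x i))%:E)%E.
    rewrite (integral_lebn_prod (g := fun i x => (\1_(B i) x * g i x)%:E)).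
    - by apply: eq_bigr => i _; rewrite hg.
    - by move=> i; apply/measurable_EFinP; exact: measurable_funM.
    - by move=> i x; rewrite lee_fin mulr_ge0.
  apply: eq_integral => x _.
  pose Bt j := [set t | B j (tnth x j) /\ subgraph (g j) (t, tnth x j)].
  have lBt j : leb (Bt j) = (\1_(B j) (tnth x j) * g j (tnth x j))%:E.
    by rewrite /Bt measure_guard EFinM; congr (_ * _)%E; exact: leb_subgraph.
  have mBt j : measurable (Bt j).
    have [Bx|nBx] := pselect (B j (tnth x j)).
      rewrite (_ : Bt j = `[0, g j (tnth x j)[%classic)//.
      by apply/seteqP; split => t // [].
    by rewrite (_ : Bt j = set0)//; apply/seteqP; split => t // [].
  transitivity (\prod_(i < n) leb (Bt i))%E; first exact: eq_bigr.
  rewrite -lebn_box//; congr (lebn n _); apply/seteqP; split => t /=.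
    by move=> h; split => i; have [] := h i.
  by move=> [h h'] i; split; [exact: h'|exact: h].
- move=> N; apply: (@le_lt_trans _ _ 1%E); last exact: ltry.
  apply: probability_le1; rewrite -[X in measurable X]setTI; apply: mJ => //.
  exact: (measurable_box (B := fun=> `[(- N%:R), N%:R]%classic)).
Qed.

End law.

(** * The two probability bounds *)

Lemma interval_hull (R : realType) (L : set R) : is_interval L -> L !=set0 ->
  L `<=` `[-1, 1]%classic -> measurable L ->
  exists a b, [/\ a <= b, L `<=` `[a, b]%classic & ((b - a)%:E <= leb L)%E].
Proof.
move=> iL L0 L1 mL.
have supL : has_sup L.
  by split => //; exists 1 => x /L1; rewrite /= in_itv/= => /andP[].
have infL : has_inf L.
  by split => //; exists (-1) => x /L1; rewrite /= in_itv/= => /andP[].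
have Lab : L `<=` `[inf L, sup L]%classic.
  move=> x Lx; rewrite /= in_itv/= (ge_inf _ Lx) ?(ub_le_sup _ Lx)//.
    by case: supL.
  by case: infL.
(* Every point strictly between inf L and sup L lies in L, so L is at least as long as the open
   interval they bound. *)
exists (inf L), (sup L).
have ab : inf L <= sup L.
  by case: L0 => x /Lab; rewrite /= in_itv/= => /andP[]; exact: le_trans.
split => //; rewrite -(leb_itv false true ab).
apply: le_measure; rewrite ?inE//.
move=> y; rewrite /= in_itv/= => /andP[ay yb].
have [x Lx xy] := inf_lt L0 ay; have [z Lz yz] := sup_gt L0 yb.
by apply: (iL x z) => //; rewrite !ltW.
Qed.

Lemma leq_ffact_expn n m : (n ^_ m <= n ^ m)%N.
Proof.
rewrite ffact_prod -[X in (_ <= _ ^ X)%N]card_ord -prod_nat_const.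
by apply: leq_prod => i _; exact: leq_subr.
Qed.

(** A relation among the rows of U, extended by zeros, is a relation among the rows of the
    invertible stacked matrix. *)
Lemma row_free_col_mxl (F : fieldType) r k (U : 'M[F]_(r, r + k))
    (V : 'M[F]_(k, r + k)) : col_mx U V \in unitmx -> row_free U.
Proof.
move=> uUV; apply: inj_row_free => v vU.
have : row_mx v 0 = 0 :> 'rV[F]_(r + k).
  by rewrite -[LHS](mulmxK uUV) mul_row_col vU mul0mx addr0 mul0mx.
by move=> /(congr1 lsubmx); rewrite row_mxKl linear0.
Qed.

Section bounds.
Context d (T : measurableType d) (R : realType) (P : probability T R) (r k : nat).
Local Notation n := (r + k)%N.
Local Notation intmx M := (map_mx (intr : int -> R) M).
Variables (X : 'I_n -> {RV P >-> R}) (g : 'I_n -> R -> R) (phi : R).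
Hypothesis hindep : mutually_independent X.
Hypothesis mg : forall i, measurable_fun setT (g i).
Hypothesis g0 : forall i x, 0 <= g i x.
Hypothesis gphi : forall i x, g i x <= phi.
Hypothesis g1 : forall i x, 0 < g i x -> x \in `[-1, 1].
Hypothesis hg : forall i (B : set R), measurable B ->
  P (X i @^-1` B) = (\int[leb]_x (\1_B x * g i x)%:E)%E.
Hypothesis phi0 : 0 <= phi.
Variables (B : 'M[int]_(r, n)) (D : 'M[int]_(k, n)).
Variables (eps : R) (C : r.-tuple R -> set (k.-tuple R)).
Hypothesis eps0 : 0 <= eps.
Hypothesis hC : forall y, is_hypercube eps (C y).
Hypothesis mC : measurable [set p : r.-tuple R * k.-tuple R | C p.1 p.2].
Hypothesis BD0 : \det (col_mx B D) != 0.
Hypothesis B1 : forall i j, `|B i j| <= 1.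

Let E := event B D C.
Let level j (s : R) : set R := [set x | subgraph (g j) (s, x)].
Let fiber t : set (n.-tuple R) := [set x | subgraphs g (t, x)].

Let mlevel j s : measurable (level j s).
Proof.
have := measurable_xsection s (measurable_subgraph (mg j)).
by rewrite xsectionE.
Qed.

Let mfiber t : measurable (fiber t).
Proof. exact: (measurable_box (B := fun j => level j (tnth t j))). Qed.

Let level_cube j s x : level j s x ->
  (s \in `[0, phi[) /\ (x \in `[-1, 1]).
Proof.
rewrite /level /subgraph/= !in_itv/= => /andP[s0 sg]; split.
  by rewrite s0 (lt_le_trans sg).
by have := g1 (le_lt_trans s0 sg); rewrite in_itv.
Qed.

Let measurable_inner :
  measurable_fun [set: n.-tuple R] (fun t => lebn n [set x | fiber t x /\ E x]).
Proof.
have mA : measurable [set q | subgraphs g q /\ E q.2]; last first.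
  exact: (measurable_section (lebn n) mA).
apply: measurableI; first exact: measurable_subgraphs.
by rewrite -[X in measurable X]setTI; apply: measurable_snd => //; exact: measurable_event.
Qed.

Let event_le (c : n.-tuple R -> \bar R) : measurable_fun setT c ->
  (forall t, lebn n [set x | fiber t x /\ E x] <= c t)%E ->
  (P [set w | E (joint X w)] <= \int[lebn n]_t c t)%E.
Proof.
move=> mc lec.
rewrite (joint_law hindep mg g0 hg); last exact: measurable_event.
by apply: ge0_le_integral => // t _; exact: lec.
Qed.

(** The fibre is empty unless t lies in [0, phi[^n, of volume phi^n. It is contained in [-1, 1]^n,
    which B maps into [-n, n]^r, of volume (2n)^r, as its entries are at most 1 in absolute
    value. *)
Lemma event_bound :
  (P [set w | E (joint X w)] <=
    ((2 * n%:R) ^+ r * phi ^+ n * eps ^+ k)%:E)%E.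
Proof.
pose Q := [set t : n.-tuple R | forall j, tnth t j \in `[0, phi[ ].
pose W := [set y : r.-tuple R | forall i, tnth y i \in `[- n%:R, n%:R] ].
have mQ : measurable Q by exact: (measurable_box (B := fun=> `[0, phi[%classic)).
have mW : measurable W by exact: (measurable_box (B := fun=> `[- n%:R, n%:R]%classic)).
have lQ : lebn n Q = (phi ^+ n)%:E.
  rewrite /Q (lebn_box (B := fun=> `[0, phi[%classic))//.
  under eq_bigr do rewrite leb_itv// subr0.
  by rewrite prodEFin prodr_const card_ord.
have lW : lebn r W = ((2 * n%:R) ^+ r)%:E.
  rewrite /W (lebn_box (B := fun=> `[- n%:R, n%:R]%classic))//.
  have nn : - n%:R <= n%:R :> R by rewrite (le_trans _ (ler0n R n))// oppr_le0.
  under eq_bigr do rewrite leb_itv// opprK -mulr2n -[_ *+ 2]mulr_natl.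
  by rewrite prodEFin prodr_const card_ord.
apply: (@le_trans _ _ (\int[lebn n]_t ((\1_Q t)%:E * (eps ^+ k * (2 * n%:R) ^+ r)%:E))%E).
  apply: event_le => [|t].
    apply: emeasurable_funM; last exact: measurable_cst.
    by apply/measurable_EFinP; exact: measurable_indic.
  have [Qt|nQt] := pselect (Q t); last first.
    rewrite (_ : [set x | _] = set0) ?measure0 ?mule_ge0 ?lee_fin ?mulr_ge0 ?exprn_ge0//.
    apply/seteqP; split => // x [xt _]; apply: nQt => j.
    by have [] := level_cube (xt j).
  rewrite indicE mem_set// mul1e EFinM -lW; apply: lebn_event_le => //.
  move=> x xt i; rewrite tnth_tcol mxE in_itv/= -ler_norml.
  apply: (le_trans (ler_norm_sum _ _ _)).
  rewrite -[X in _ <= X%:R]card_ord -sum1_card natr_sum; apply: ler_sum => j _.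
  rewrite normrM !mxE -intr_norm mulr_ile1//.
    by rewrite -[leRHS]/(1%:~R) ler_int.
  by have [_] := level_cube (xt j); rewrite in_itv/= -ler_norml.
rewrite integral_indicZ// ?lee_fin ?mulr_ge0 ?exprn_ge0 ?mulr_ge0//.
apply: (@le_trans _ _ ((phi ^+ n)%:E * (eps ^+ k * (2 * n%:R) ^+ r)%:E)%E).
  by rewrite -lQ.
by rewrite -EFinM mulrCA mulrC (mulrC (phi ^+ n)).
Qed.

Hypothesis gint : forall j s, 0 <= s -> is_interval [set x | s < g j x].

Lemma event_bound_quasiconcave :
  (P [set w | E (joint X w)] <=
    (2 ^+ k * n%:R ^+ r * phi ^+ k * eps ^+ k)%:E)%E.
Proof.
(* For fixed S the bound is a product over the coordinates of t: the length of the superlevel set at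
   a free coordinate, the indicator of [0, phi[ elsewhere. *)
pose h (S : {set 'I_n}) (j : 'I_n) (s : R) : \bar R :=
  if j \in S then leb (level j s) else (\1_(`[0, phi[%classic) s)%:E.
have mh S j : measurable_fun setT (h S j).
  rewrite /h; case: (j \in S); last first.
    by apply/measurable_EFinP; exact: measurable_indic.
  exact: (measurable_section leb (measurable_subgraph (mg j))).
have h0 S j s : (0 <= h S j s)%E.
  by rewrite /h; case: ifP; rewrite ?measure_ge0 ?lee_fin.
(* By Tonelli the lengths of the superlevel sets of g_j integrate to its total mass 1. *)
have int_h S j : (\int[leb]_s h S j s = (if j \in S then 1 else phi)%:E)%E.
  rewrite /h; case: (j \in S).
    rewrite (tonelli_sections leb leb (measurable_subgraph (mg j))).
    rewrite -(probability_setT P) -(preimage_setT (X j)) hg//.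
    by apply: eq_integral => x _; rewrite indicT mul1r; exact: leb_subgraph.
  rewrite integral_indic// setIT -[in RHS](subr0 phi); exact: leb_itv.
pose s := [seq S : {set 'I_n} <- index_enum {set 'I_n} | #|S| == r].
(* eps^k comes from the hypercubes and 2^k r! from the faces with free coordinates S. *)
pose c : R := eps ^+ k * (2 ^ k * r`!)%:R.
have c0 : 0 <= c by rewrite mulr_ge0 ?exprn_ge0.
apply: (@le_trans _ _ (\int[lebn n]_t
    (\sum_(S <- s) (c%:E * \prod_j h S j (tnth t j)))%E)%E).
  apply: event_le => [|t].
    apply: emeasurable_sum => S; apply: emeasurable_funM => //.
    apply: emeasurable_prod => j.
    by apply: measurableT_comp => //; exact: measurable_tnth.
  have p0 S : (0 <= \prod_j h S j (tnth t j))%E by exact: prode_ge0.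
  (* If some superlevel set is empty, so is the fibre. Otherwise every t_j lies in [0, phi[, and the
     superlevel sets, being intervals, have closed hulls no longer than themselves. *)
  have [Lt|/existsNP[j Lj]] :=
    pselect (forall j, level j (tnth t j) !=set0); last first.
    have -> : [set x | fiber t x /\ E x] = set0.
      by apply/seteqP; split => // x [xt _]; apply: Lj; exists (tnth x j); exact: (xt j).
    by rewrite measure0; apply: sume_ge0 => S _; rewrite mule_ge0.
  have t0 j : (tnth t j \in `[0, phi[) by have [x /level_cube[]] := Lt j.
  have /boolp.choice[a /boolp.choice[b ab]] : forall j, exists a b, [/\ a <= b,
      level j (tnth t j) `<=` `[a, b]%classic &
      ((b - a)%:E <= leb (level j (tnth t j)))%E].
    move=> j; apply: interval_hull => //.
      have tj0 : 0 <= tnth t j by have := t0 j; rewrite in_itv/= => /andP[].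
      rewrite (_ : level _ _ = [set x | tnth t j < g j x]); first exact: gint.
      by apply/seteqP; split => x; rewrite /level /subgraph/= in_itv/= tj0.
    by move=> x /level_cube[].
  have fB : row_free (intmx B).
    apply: (@row_free_col_mxl _ _ _ _ (intmx D)).
    by rewrite -map_col_mx; exact: unitmx_int.
  have [|W [mW BW lW]] := lebn_image_box (a := a) (b := b) B1 fB.
    by move=> j; have [] := ab j.
  apply: (@le_trans _ _ ((eps ^+ k)%:E * lebn r W)%E).
    apply: lebn_event_le => // x xt; apply: BW => j.
    have [_ /(_ (tnth x j) (xt j)) + _] := ab j.
    by rewrite mxE /= in_itv.
  apply: (@le_trans _ _ ((eps ^+ k)%:E * _)%E).
    by apply: lee_wpmul2l lW; rewrite lee_fin exprn_ge0.
  rewrite -EFinM mulr_sumr -sumEFin /s big_filter; apply: lee_sum => S _.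
  rewrite mulrA EFinM lee_wpmul2l ?lee_fin//.
  rewrite -prodEFin [leRHS](bigID (mem S))/= [X in (_ * X)%E]big1 ?mule1; last first.
    by move=> j jS; rewrite /h (negPf jS) indicE mem_set//; exact: t0.
  suff [] : (0 <= \prod_(j in S) (b j - a j)%:E)%E /\
    (\prod_(j in S) (b j - a j)%:E <= \prod_(j in S) h S j (tnth t j))%E by [].
  apply: (big_ind2 (fun x y : \bar R => (0 <= x)%E /\ (x <= y)%E)) => //.
    by move=> x1 x2 y1 y2 [? ?] [? ?]; rewrite mule_ge0// lee_pmul.
  move=> j jS; have [ab0 _ abL] := ab j.
  by rewrite lee_fin subr_ge0 /h jS.
have mprod S : measurable_fun [set: n.-tuple R] (fun t => \prod_j h S j (tnth t j))%E.
  apply: emeasurable_prod => j.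
  by apply: measurableT_comp => //; exact: measurable_tnth.
have prod0 S t : (0 <= \prod_j h S j (tnth t j))%E by exact: prode_ge0.
rewrite ge0_integral_sum//; last 2 first.
- by move=> S; exact: emeasurable_funM.
- by move=> S t _; rewrite mule_ge0.
rewrite /s big_filter (eq_bigr (fun=> (c * phi ^+ k)%:E)) => [|S /eqP cS]; last first.
  rewrite ge0_integralZl// [RHS]EFinM; congr (_ * _)%E.
  rewrite [LHS](integral_lebn_prod (mh S) (h0 S)).
  rewrite (eq_bigr _ (fun j _ => int_h S j)) prodEFin; congr EFin.
  rewrite (bigID (mem S))/= big1 ?mul1r => [|j ->//].
  transitivity (\prod_(j in ~: S) phi).
    by apply: eq_big => [j|j /negPf ->//]; rewrite inE.
  rewrite prodr_const; congr (_ ^+ _).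
  by apply/(@addnI #|S|); rewrite cardsC card_ord cS.
(* There are C(n, r) sets S, and C(n, r) r! is a falling factorial, at most n^r. *)
rewrite sumEFin lee_fin sumr_const -cardsE card_draws card_ord.
rewrite -[leLHS]mulr_natr [leLHS](_ : _ =
    eps ^+ k * phi ^+ k * (2 ^ k * ('C(n, r) * r`!))%:R); last first.
  by rewrite /c !natrM; ring.
rewrite bin_ffact [leRHS](_ : _ = eps ^+ k * phi ^+ k * (2 ^ k * n ^ r)%:R).
  by rewrite ler_wpM2l ?mulr_ge0 ?exprn_ge0// ler_nat leq_mul2l leq_ffact_expn orbT.
have -> : (2 ^ k * n ^ r)%:R = 2 ^+ k * n%:R ^+ r :> R by rewrite natrM !natrX.
by ring.
Qed.

End bounds.

(** * Densities extended to the line *)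

Section density.
Context d (T : measurableType d) (R : realType) (P : probability T R).
Variables (X : {RV P >-> R}) (phi : R) (f : R -> R).
Hypothesis hX : has_density X phi f.

(** Extension by zero lets the integrals range over the whole line and confines the superlevel sets
    of nonnegative levels to [-1, 1]. *)
Let g := f \_ `[-1, 1]%classic.

Let gE x : g x = if x \in `[-1, 1] then f x else 0.
Proof. by rewrite /g patchE mem_setE. Qed.

Lemma measurable_density : measurable_fun setT g.
Proof. by have [mf _ _] := hX; apply/(measurable_restrictT f). Qed.

Lemma density_ge0 x : 0 <= g x.
Proof. by have [_ f0 _] := hX; rewrite gE; case: ifPn => // /f0 /andP[]. Qed.

Lemma density_bound_ge0 : 0 <= phi.
Proof.
have [_ f0 _] := hX; have : (0 : R) \in `[-1, 1] by rewrite in_itv/= lerN10 ler01.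
by move=> /f0 /andP[]; exact: le_trans.
Qed.

Lemma density_le x : g x <= phi.
Proof.
have [_ f0 _] := hX; rewrite gE; case: ifPn => [/f0 /andP[]//|_].
exact: density_bound_ge0.
Qed.

Lemma density_support x : 0 < g x -> x \in `[-1, 1].
Proof. by rewrite gE; case: ifP => //; rewrite ltxx. Qed.

Lemma density_law (B : set R) : measurable B ->
  P (X @^-1` B) = (\int[leb]_x (\1_B x * g x)%:E)%E.
Proof.
move=> mB; have [_ _ /(_ B mB)] := hX; rewrite /distribution /pushforward => ->.
rewrite -integral_leb; last 2 first.
- apply/measurable_EFinP; apply: measurable_funM; last exact: measurable_density.
  exact: measurable_indic.
- by move=> x; rewrite lee_fin mulr_ge0// density_ge0.
rewrite integral_mkcond; apply: eq_integral => x _.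
rewrite patchE in_setI indicE gE mem_setE.
by case: (x \in B); case: (x \in `[-1, 1]); rewrite ?mul1r ?mul0r.
Qed.

(** A point z between x and y lies on one side of the peak x0, where monotonicity makes f z at least
    f x or at least f y. *)
Lemma density_is_interval s : quasiconcave f -> 0 <= s ->
  is_interval [set x | s < g x].
Proof.
move=> [x0 [_ fl fr]] s0 x y /= sx sy z /andP[xz zy].
have x1 := density_support (le_lt_trans s0 sx).
have y1 := density_support (le_lt_trans s0 sy).
move: sx sy; rewrite !gE x1 y1; move: x1 y1; rewrite !in_itv/=.
move=> /andP[x1 x2] /andP[y1 y2] sx sy.
rewrite (le_trans x1 xz) (le_trans zy y2)/=.
have [zx0|x0z] := leP z x0.
  apply: (lt_le_trans sx); apply: fl => //; rewrite in_itv/=.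
    by rewrite x1 (le_trans xz).
  by rewrite (le_trans x1 xz).
apply: (lt_le_trans sy); apply: fr => //; rewrite in_itv/=.
  by rewrite y2 (le_trans (ltW x0z)).
by rewrite (ltW x0z) (le_trans zy).
Qed.

End density.

(** * Reduction to an invertible integer matrix *)

Lemma submx_col_mxl (F : fieldType) p q n (U : 'M[F]_(p, n)) (V : 'M[F]_(q, n)) :
  (U <= col_mx U V)%MS.
Proof. by rewrite -addsmxE addsmxSl. Qed.

Lemma submx_col_mxr (F : fieldType) p q n (U : 'M[F]_(p, n)) (V : 'M[F]_(q, n)) :
  (V <= col_mx U V)%MS.
Proof. by rewrite -addsmxE addsmxSr. Qed.

Lemma sign_matrix_int (R : realType) m n (A : 'M[R]_(m, n)) :
  (forall i j, A i j \in [:: -1; 0; 1]) ->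
  exists2 M : 'M[int]_(m, n), A = map_mx intr M & forall i j, `|M i j| <= 1.
Proof.
move=> hA; exists (\matrix_(i, j) if A i j == 1 then 1 else if A i j == -1 then -1 else 0).
  apply/matrixP => i j; rewrite !mxE; have := hA i j; rewrite !inE.
  have N11 : (-1 == 1 :> R) = false by apply/negbTE; rewrite lt_eqF// ltrN10 // ltr01.
  by move=> /or3P[] /eqP ->; rewrite ?N11 ?eqxx// eq_sym oner_eq0 eq_sym oppr_eq0 oner_eq0.
by move=> i j; rewrite mxE; case: ifP => // _; case: ifP.
Qed.

Unset Implicit Arguments.

Theorem theorem4 (d : measure_display) (T : measurableType d) (R : realType)
    (P : probability T R) (n m k : nat)
    (hm : (0 < m)%N) (hmn : (m <= n)%N) (hk : (0 < k)%N) (hkm : (k < m)%N)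
    (phi eps : R) (heps : 0 <= eps)
    (X : 'I_n -> {RV P >-> R}) (f : 'I_n -> R -> R)
    (hindep : mutually_independent X)
    (hdens : forall i : 'I_n, has_density (X i) phi (f i))
    (A : 'M[R]_(m, n))
    (hA : forall (i : 'I_m) (j : 'I_n), A i j \in [:: -1; 0; 1])
    (hrank : \rank A = minn m n)
    (C : (m - k).-tuple R -> set (k.-tuple R))
    (hC : forall y : (m - k).-tuple R, is_hypercube eps (C y))
    (hCmeas : measurable
       [set p : (m - k).-tuple R * k.-tuple R | C p.1 p.2]) :
  let AX (w : T) : 'cV[R]_m := A *m \col_(i < n) X i w in
  let Y (w : T) : (m - k).-tuple R := head_coords hkm (AX w) in
  let Z (w : T) : k.-tuple R := tail_coords hkm (AX w) in
  (P [set w | C (Y w) (Z w)]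
     <= ((2 * n%:R) ^+ (n - k) * phi ^+ n * eps ^+ k)%:E)%E /\
  ((forall i : 'I_n, quasiconcave (f i)) ->
   (P [set w | C (Y w) (Z w)]
      <= (2 ^+ k * n%:R ^+ (n - k) * phi ^+ k * eps ^+ k)%:E)%E).
Proof.
move=> AX Y Z.
(* s = n - m unit rows are added to A, which leaves r = n - k rows for B. *)
have [s ns] : exists s, n = (m - k + s + k)%N by exists (n - m)%N; lia.
subst n; set r := (m - k + s)%N in X f hindep hdens A hA hrank AX Y Z hmn *.
have phi0 : 0 <= phi.
  by apply: (density_bound_ge0 (hdens (Ordinal (leq_trans hm hmn)))).
have [M AM M1] := sign_matrix_int hA.
have [e eA] : exists e : 'I_s -> 'I_(r + k), row_full (col_mx A (rowsub e 1%:M)).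
  apply: unit_rows_completion; rewrite hrank (minn_idPl hmn) /r.
  by rewrite addnAC subnK// ltnW.
pose hrow (i : 'I_(m - k)) : 'I_m := cast_ord (subnK (ltnW hkm)) (lshift k i).
pose trow (j : 'I_k) : 'I_m := cast_ord (subnK (ltnW hkm)) (rshift (m - k) j).
pose B : 'M[int]_(r, r + k) := col_mx (rowsub hrow M) (rowsub e 1%:M).
pose D : 'M[int]_(k, r + k) := rowsub trow M.
(* The hypercube depends only on Y, the first m - k coordinates of B x. *)
pose C' (y : r.-tuple R) : set (k.-tuple R) := C (fst_tuple y).
have mC' : measurable [set p : r.-tuple R * k.-tuple R | C' p.1 p.2].
  have : measurable_fun setT
      (fun p : r.-tuple R * k.-tuple R => (fst_tuple p.1, p.2)).
    apply: measurable_fun_pair; last exact: measurable_snd.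
    apply: measurableT_comp; last exact: measurable_fst.
    exact: measurable_fst_tuple.
  by move=> /(_ measurableT _ hCmeas); rewrite setTI.
have B1 i j : `|B i j| <= 1.
  rewrite mxE; case: splitP => l _; first by rewrite mxE M1.
  by rewrite !mxE; case: eqP.
have intB : map_mx intr B = col_mx (rowsub hrow A) (rowsub e 1%:M).
  by rewrite map_col_mx !map_mxsub -AM map_mx1.
have intD : map_mx intr D = rowsub trow A by rewrite map_mxsub -AM.
have BD0 : \det (col_mx B D) != 0.
  suff : (map_mx intr (col_mx B D) : 'M[R]_(r + k)) \in unitmx.
    by rewrite unitmxE det_map_mx unitfE intr_eq0.
  (* The rows of A and the added unit rows span everything, and each of them occurs in B or D. *)
  rewrite -row_full_unit -sub1mx map_col_mx intB intD.
  move: eA; rewrite -sub1mx => /submx_trans; apply.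
  rewrite col_mx_sub; apply/andP; split; last first.
    exact: submx_trans (submx_col_mxr _ _) (submx_col_mxl _ _).
  apply/row_subP => i.
  have -> : i = cast_ord (subnK (ltnW hkm)) (cast_ord (esym (subnK (ltnW hkm))) i).
    by apply/val_inj.
  case: (split_ordP (cast_ord (esym (subnK (ltnW hkm))) i)) => j ->.
    apply: submx_trans (submx_trans (submx_col_mxl _ _) (submx_col_mxl _ _)).
    by have := row_sub j (rowsub hrow A); rewrite row_rowsub.
  apply: submx_trans (submx_col_mxr _ _).
  by have := row_sub j (rowsub trow A); rewrite row_rowsub.
have event_joint w : event B D C' (joint X w) = C (Y w) (Z w).
  have colX : colt (joint X w) = \col_i X i w.
    by apply/colP => i; rewrite !mxE tnth_mktuple.
  rewrite /event /C' intB intD mul_col_mx fst_tuple_col_mx colX.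
  rewrite !mul_rowsub_mx; congr C.
    by apply: eq_from_tnth => i; rewrite tnth_tcol tnth_mktuple mxE.
  by apply: eq_from_tnth => i; rewrite tnth_tcol tnth_mktuple mxE.
have -> : [set w | C (Y w) (Z w)] = [set w | event B D C' (joint X w)].
  by apply/seteqP; split => w /=; rewrite event_joint.
pose g i := f i \_ `[-1, 1]%classic.
have mg i : measurable_fun setT (g i) by exact: measurable_density (hdens i).
have g0 i x : 0 <= g i x by exact: density_ge0 (hdens i) x.
have gphi i x : g i x <= phi by exact: density_le (hdens i) x.
have g1 i x : 0 < g i x -> x \in `[-1, 1] by exact: density_support.
have hg i := density_law (hdens i).
have hC' y : is_hypercube eps (C' y) by exact: hC.
rewrite addnK; split; first exact: event_bound.
move=> hq; apply: event_bound_quasiconcave => // j t t0.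
exact: density_is_interval.
Qed.
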